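(* Let $m\ge1$ be an integer, let $\alpha,\beta,\gamma\in\mathbb{C}$ with $(\alpha,\gamma)\ne(0,0)$, and let $\varphi(z)=\gamma\overline{z}^m+\alpha z^m+\beta$. Then the Toeplitz operator $T_\varphi$ on $L^2_a(\mathbb{D})$ is of Coburn type, i.e. $\ker T_\varphi=\{0\}$ or $\ker T_\varphi^*=\{0\}$.
   Context: $\mathbb{D}$ is the open unit disk in $\mathbb{C}$ and $dA$ is the normalized Lebesgue area measure on $\mathbb{D}$. The Bergman space $L^2_a(\mathbb{D})$ is the closed subspace of analytic functions in $L^2(\mathbb{D},dA)$, and $P:L^2(\mathbb{D},dA)\to L^2_a(\mathbb{D})$ is the orthogonal projection. For $\varphi\in L^\infty(\mathbb{D},dA)$ the Toeplitz operator is $T_\varphi f=P(\varphi f)$ on $L^2_a(\mathbb{D})$. A non-scalar bounded linear operator $T$ on a Hilbert space is of Coburn type if either $\ker T$ or $\ker T^*$ equals $\{0\}$. *)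

(* Defs.v *)
From HB Require Import structures.
From mathcomp Require Import all_boot all_order all_algebra.
From mathcomp Require Import complex.
From mathcomp Require Import all_classical all_reals all_analysis.
From mathcomp Require Import measurable_realfun ring lra.

Set Implicit Arguments.
Unset Strict Implicit.
Unset Printing Implicit Defensive.

Import Order.TTheory GRing.Theory Num.Theory.
Import numFieldNormedType.Exports.
Import Normc.

Local Open Scope classical_set_scope.
Local Open Scope ring_scope.
Local Open Scope complex_scope.

(* Operators on a complex Hilbert space [V] with inner product [dot], linear in
   its first argument and conjugate-linear in the second. *)
Section Operators.
Context {R : realType} {V : lmodType R[i]} (dot : V -> V -> R[i]).

Definition hnorm (f : V) : R := Num.sqrt (complex.Re (dot f f)).

Definition bounded_linear (T : V -> V) : Prop :=
  linear T /\ exists M : R, forall f, hnorm (T f) <= M * hnorm f.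

Definition scalar_operator (T : V -> V) : Prop :=
  exists c : R[i], forall f, T f = c *: f.

(* [adjoint T g] is the vector [h] such that [dot (T f) g = dot f h] for all
   [f]; it exists by the Riesz theorem when [T] is bounded and [V] is complete,
   and it is unique. The value 0 is only a default. *)
Definition adjoint (T : V -> V) (g : V) : V :=
  xget 0 [set h | forall f, dot (T f) g = dot f h].

Definition ker (T : V -> V) : set V := [set f | T f = 0].

Definition coburn_type (T : V -> V) : Prop :=
  [/\ bounded_linear T, ~ scalar_operator T &
      ker T = [set 0] \/ ker (adjoint T) = [set 0]].

End Operators.

Section Bergman.
Context {R : realType}.

Definition disk : set R[i] := [set z | `|z| < 1].

Definition toC (p : measurableTypeR R * measurableTypeR R) : R[i] :=
  p.1 +i* p.2.

Definition disk2 : set (measurableTypeR R * measurableTypeR R) :=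
  toC @^-1` disk.

Lemma invr_pi_ge0 : 0 <= (pi : R)^-1.
Proof. by rewrite invr_ge0 pi_ge0. Qed.

(* Area on the plane scaled by 1/pi; all the integrals below are over [disk2],
   which has mass 1. *)
Definition dA :
    {measure set (measurableTypeR R * measurableTypeR R) -> \bar R} :=
  mscale (NngNum invr_pi_ge0) (@lebesgue_measure R \x @lebesgue_measure R)%E.

Definition cintegral (F : R[i] -> R[i]) : R[i] :=
  (\int[dA]_(p in disk2) complex.Re (F (toC p)))
  +i* (\int[dA]_(p in disk2) complex.Im (F (toC p))).

(* The condition only concerns the values of [f] on the disk; the elements of
   L^2 are represented by functions, not by classes up to a.e. equality. *)
Definition L2 (f : R[i] -> R[i]^o) : Prop :=
  [/\ measurable_fun disk2 (fun p => complex.Re (f (toC p))),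
      measurable_fun disk2 (fun p => complex.Im (f (toC p))) &
      (\int[dA]_(p in disk2) (normc (f (toC p)) ^+ 2)%:E < +oo)%E].

Definition dotL2 (f g : R[i] -> R[i]^o) : R[i] :=
  cintegral (fun z => f z * (g z)^*%C).

Definition analytic (f : R[i] -> R[i]^o) : Prop :=
  forall z, disk z -> exists (a : nat -> R[i]) (r : R), 0 < r /\
    forall w, `|w - z| < r%:C ->
      series (fun n => a n * (w - z) ^+ n : R[i]^o) @ \oo --> f w.

(* Extending by 0 outside the disk makes Leibniz equality of total functions
   coincide with equality of functions on the disk. *)
Definition bergman_pred : {pred R[i] -> R[i]^o} := fun f =>
  `[< [/\ L2 f, analytic f & forall z, ~ disk z -> f z = 0] >].

Lemma measurable_disk2 : measurable disk2.
Proof.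
have -> : disk2 = setT `&` (fun p : measurableTypeR R * measurableTypeR R =>
   p.1 ^+ 2 + p.2 ^+ 2 : measurableTypeR R) @^-1` `]-oo, 1[%classic.
  apply/seteqP; split=> -[x y]; rewrite /disk2 /toC /disk /= in_itv/=.
    rewrite normc_def ltcR => h; split=> //; rewrite ltNge; apply/negP => h1.
    by move: h; rewrite -[1]sqrtr1 ltNge ler_wsqrtr.
  move=> [_ h]; rewrite normc_def ltcR -[1]sqrtr1 ltr_sqrt//.
suff m : measurable_fun setT (fun p : measurableTypeR R * measurableTypeR R =>
   p.1 ^+ 2 + p.2 ^+ 2 : measurableTypeR R) by apply: m.
by apply: measurable_funD; apply: measurable_funX.
Qed.

Lemma normc2E (z : R[i]) :
  normc z ^+ 2 = complex.Re z ^+ 2 + complex.Im z ^+ 2.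
Proof. by case: z => x y /=; rewrite sqr_sqrtr// addr_ge0// sqr_ge0. Qed.

Lemma measurable_normc2 (f : R[i] -> R[i]^o) : L2 f ->
  measurable_fun disk2 (fun p => (normc (f (toC p)) ^+ 2)%:E).
Proof.
case=> mr mi _; apply/measurable_EFinP.
under eq_fun do rewrite normc2E.
by apply: measurable_funD; apply: measurable_funX.
Qed.

Lemma L2Z (c : R[i]) f : L2 f -> L2 (c *: f).
Proof.
move=> Lf; have mn := measurable_normc2 Lf; case: Lf => mr mi fi.
case: c => a b; split.
- have -> : (fun p => complex.Re (((a +i* b) *: f) (toC p))) =
     (fun p => a * complex.Re (f (toC p))) \- (fun p => b * complex.Im (f (toC p))).
    by apply/funext => p /=; rewrite /GRing.scale/=; case: (f (toC p)).
  by apply: measurable_funB; apply: measurable_funM.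
- have -> : (fun p => complex.Im (((a +i* b) *: f) (toC p))) =
     (fun p => a * complex.Im (f (toC p))) \+ (fun p => b * complex.Re (f (toC p))).
    apply/funext => p /=; rewrite /GRing.scale/=; case: (f (toC p)) => u v /=.
    by rewrite [RHS]addrC addrC.
  by apply: measurable_funD; apply: measurable_funM.
- under eq_integral do rewrite normcM exprMn EFinM.
  rewrite ge0_integralZl_EFin//=; first last.
  all: rewrite ?sqr_ge0//.
  all: try exact: measurable_disk2.
  all: try by move=> p _; rewrite lee_fin sqr_ge0.
  by rewrite lte_mul_pinfty// lee_fin sqr_ge0.
Qed.

Lemma sqr2D_le (a b c d : R) :
  (a + c) ^+ 2 + (b + d) ^+ 2 <= 2 * (a ^+ 2 + b ^+ 2 + (c ^+ 2 + d ^+ 2)).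
Proof. by have := sqr_ge0 (a - c); have := sqr_ge0 (b - d); nra. Qed.

Lemma L2D f g : L2 f -> L2 g -> L2 (f + g).
Proof.
move=> Lf Lg; have mf := measurable_normc2 Lf; have mg := measurable_normc2 Lg.
have m1 : measurable_fun disk2 (fun p => complex.Re ((f + g) (toC p))).
  under eq_fun do rewrite raddfD/=.
  by case: Lf Lg => + _ _ [+ _ _]; exact: measurable_funD.
have m2 : measurable_fun disk2 (fun p => complex.Im ((f + g) (toC p))).
  under eq_fun do rewrite raddfD/=.
  by case: Lf Lg => _ + _ [_ + _]; exact: measurable_funD.
split=> //; case: Lf Lg => _ _ fi [_ _ gi].
apply: (@le_lt_trans _ _ (\int[dA]_(p in disk2)
   (2%:E * ((normc (f (toC p)) ^+ 2)%:E + (normc (g (toC p)) ^+ 2)%:E)))%E).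
  apply: ge0_le_integral => //=.
  - exact: measurable_disk2.
  - by move=> p _; rewrite lee_fin sqr_ge0.
  - apply/measurable_EFinP; under eq_fun do rewrite normc2E.
    by apply: measurable_funD; apply: measurable_funX.
  - by apply: measurable_funeM; apply: emeasurable_funD.
  - move=> p _; rewrite -EFinD -EFinM lee_fin !normc2E !raddfD.
    exact: sqr2D_le.
rewrite ge0_integralZl_EFin//=.
all: try exact: measurable_disk2.
all: try exact: emeasurable_funD.
all: try by move=> p _; rewrite -EFinD lee_fin addr_ge0// sqr_ge0.
rewrite ge0_integralD//=.
all: try exact: measurable_disk2.
all: try by move=> p _; rewrite lee_fin sqr_ge0.
by apply: lte_mul_pinfty => //; exact: lte_add_pinfty.
Qed.

Lemma L20 : L2 0.
Proof.
split.
- exact: measurable_cst.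
- exact: measurable_cst.
- under eq_integral do rewrite normc0 expr0n.
  by rewrite integral0.
Qed.

Lemma analytic0 : analytic 0.
Proof.
move=> z _; exists (fun=> 0), 1; split=> // w _.
rewrite [X in X @ _ --> _](_ : _ = cst 0); first exact: cvg_cst.
by apply/funext => n; rewrite /series/= big1// => i _; rewrite mul0r.
Qed.

Lemma analyticZD (c : R[i]) f g :
  analytic f -> analytic g -> analytic (c *: f + g).
Proof.
move=> af ag z Dz; have [a [r [r0 ha]]] := af z Dz.
have [b [s [s0 hb]]] := ag z Dz.
exists (fun n => c * a n + b n), (Order.min r s); split.
  by rewrite lt_min r0.
move=> w hw; have hr : `|w - z| < r%:C.
  by apply: lt_le_trans hw _; rewrite lecR ge_min lexx.
have hs : `|w - z| < s%:C.
  by apply: lt_le_trans hw _; rewrite lecR ge_min lexx orbT.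
have -> : series (fun n => (c * a n + b n) * (w - z) ^+ n : R[i]^o) =
    c *: series (fun n => a n * (w - z) ^+ n : R[i]^o)
    + series (fun n => b n * (w - z) ^+ n : R[i]^o).
  apply/funext => n; rewrite !fctE /series/= scaler_sumr -big_split/=.
  by apply: eq_bigr => i _; rewrite mulrDl -mulrA.
apply: cvgD; last exact: hb.
by apply: cvgZr; exact: ha.
Qed.

Lemma bergman_submod_closed : submod_closed bergman_pred.
Proof.
split; first by apply/asboolP; split=> //; [exact: L20|exact: analytic0].
move=> c f g /asboolP[Lf af f0] /asboolP[Lg ag g0]; apply/asboolP; split.
- by apply: L2D => //; apply: L2Z.
- exact: analyticZD.
- by move=> z Dz /=; rewrite !fctE f0// g0// scaler0 addr0.
Qed.

HB.instance Definition _ :=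
  GRing.isSubmodClosed.Build R[i] (R[i] -> R[i]^o) bergman_pred
    bergman_submod_closed.

End Bergman.

Record bergman (R : realType) := Bergman {
  bergman_fun :> R[i] -> R[i]^o;
  bergmanP : bergman_fun \in bergman_pred }.

Section BergmanTheory.
Context {R : realType}.

HB.instance Definition _ := [isSub for @bergman_fun R].
HB.instance Definition _ := [Choice of bergman R by <:].
HB.instance Definition _ := [SubChoice_isSubLmodule of bergman R by <:].

Definition bergman_dot (f g : bergman R) : R[i] := dotL2 f g.

(* For [g] satisfying [L2] this is the orthogonal projection onto the Bergman
   space, a closed subspace of L^2. The value 0 is only a default. *)
Definition bergman_proj (g : R[i] -> R[i]^o) : bergman R :=
  xget 0 [set h : bergman R | forall k : bergman R,
    dotL2 (fun z => g z - h z) k = 0].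

Definition toeplitz (phi : R[i] -> R[i]) (f : bergman R) : bergman R :=
  bergman_proj (fun z => phi z * f z).

End BergmanTheory.

(* Main.v *)
Require Import Defs.
From mathcomp Require Import all_boot all_order all_algebra.
From mathcomp Require Import complex.
From mathcomp Require Import all_classical all_reals all_analysis.
From mathcomp Require Import measurable_realfun ring lra.
Set Implicit Arguments.
Unset Strict Implicit.
Unset Printing Implicit Defensive.
Import Order.TTheory GRing.Theory Num.Theory.
Import numFieldNormedType.Exports.
Import Normc.
Local Open Scope classical_set_scope.
Local Open Scope ring_scope.
Local Open Scope complex_scope.

(** Kernel. Write [w = z^m], [symb = gamma w^* + alpha w + beta], and let
[|gamma| <= |alpha|], [alpha <> 0]. If [f <> 0] and [symb f] is orthogonal to the
Bergman space, let [w0] be the mean of [w] for the measure [|f|^2 dA]. Testing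
against [f] gives [symb = alpha (w - w0) + gamma (w - w0)^*]; testing against
[alpha (w - w0) f] gives [|| symb f ||^2 + || alpha (w - w0) f ||^2 =
|| gamma (w - w0)^* f ||^2], so [symb f = 0] and [f = 0]. For
[|gamma| > |alpha|] the same applies to the adjoint, whose symbol is the
conjugate one, and a scalar operator is excluded by moving the scalar into
[beta].

Projection. It exists because the Bergman space is complete, which follows from
local power series expansions whose coefficients are bounded functionals on L^2.
With a radial C^1 cutoff [eta] around [z0] that is constant near [z0], and
[omega (z - z0)] proportional to its d-bar derivative, Green's formula for
[eta(w) (h(w) - h(z)) / (w - z)] gives
[int omega(w) (w - z0) (h(w) - h(z)) / (w - z) dA(w) = 0]; expanding
[(w - z0) / (w - z)] in a geometric series yields the coefficients
[int h omega (w - z0)^-n dA] up to a constant. Areas only enter through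
one-dimensional integration by parts and Fubini's theorem, so no polar
coordinates are needed. *)

(** Strict differentiability is the one regularity notion used throughout: power series have it,
    algebra preserves it, and when it holds everywhere the partial derivatives are automatically
    continuous, so the fundamental theorem of calculus applies on lines.

    An area kernel [omega] replaces a Cauchy circle because coefficients must be pairings with L^2
    functions, to which Cauchy-Schwarz applies. Subtracting [h z] removes the pole at [w = z], so
    Green's formula meets no singularity and no residue is computed. The price is [h z] times the
    moments of [omega]; by rotation invariance all of them vanish except the zeroth, which is
    positive and is divided out.

    Green's formula is used for [eta] and again for [omega], which comes from the gradient of [eta];
    hence the cubes of positive parts in [eta].

    On the support of [omega] one has [|w - z0| >= s], while [|z - z0| <= s / 2]; the ratio 1/2 of
    the geometric series is the source of every factor [2^-1 ^+ N]. *)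

(** * Complex moduli and integrals over the disk *)

Section ComplexModulus.
Context {R : realType}.
Implicit Types (z w : R[i]) (x : R).

Lemma normc_ge0 z : 0 <= normc z.
Proof. by case: z => a b; rewrite sqrtr_ge0. Qed.

Lemma normc_eq0P z : normc z = 0 <-> z = 0.
Proof. by split=> [|->]; [exact: eq0_normc|exact: normc0]. Qed.

Lemma normc_conj z : normc z^*%C = normc z.
Proof. by case: z => a b /=; rewrite sqrrN. Qed.

Lemma normcX z n : normc (z ^+ n) = normc z ^+ n.
Proof. by elim: n => [|n ih]; rewrite ?normc1// !exprS normcM ih. Qed.

Lemma normc_real x : normc x%:C = `|x|.
Proof. by rewrite /= expr0n addr0 sqrtr_sqr. Qed.

Lemma normc_sym z w : normc (z - w) = normc (w - z).
Proof. by rewrite -normcN opprB. Qed.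

Lemma normc_dist_trans u z w : normc (z - w) <= normc (z - u) + normc (u - w).
Proof. by apply: le_trans (le_normcD _ _); rewrite addrA subrK. Qed.

Lemma normc_subD z w : normc z - normc w <= normc (z - w).
Proof. by rewrite lerBlDr -{1}(subrK w z) le_normcD. Qed.

Lemma absRe_le_normc z : `|complex.Re z| <= normc z.
Proof. by case: z => a b /=; rewrite -sqrtr_sqr ler_wsqrtr// lerDl sqr_ge0. Qed.

Lemma absIm_le_normc z : `|complex.Im z| <= normc z.
Proof. by case: z => a b /=; rewrite -sqrtr_sqr ler_wsqrtr// lerDr sqr_ge0. Qed.

Lemma normc_leReIm z : normc z <= `|complex.Re z| + `|complex.Im z|.
Proof.
case: z => a b /=; rewrite -[leRHS]ger0_norm ?addr_ge0// -sqrtr_sqr ler_wsqrtr//.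
rewrite sqrrD !real_normK ?num_real// lerD2r lerDl mulrn_wge0// mulr_ge0.
Qed.

Lemma mulcJ z : z * z^*%C = (normc z ^+ 2)%:C.
Proof. by rewrite normc2E; case: z => a b /=; congr Complex; ring. Qed.

Lemma diskE z : disk z <-> normc z < 1.
Proof. by rewrite /disk /= -[`|z|]/((normc z)%:C) ltcR. Qed.

Lemma normc_sum I (r : seq I) (P : pred I) (F : I -> R[i]) :
  normc (\sum_(i <- r | P i) F i) <= \sum_(i <- r | P i) normc (F i).
Proof.
elim/big_ind2 : _ => [|a b c d ab cd|//]; first by rewrite normc0.
by apply: le_trans (le_normcD _ _) _; exact: lerD.
Qed.

Lemma complexD (a b c d : R) : (a +i* b) + (c +i* d) = (a + c) +i* (b + d).
Proof. by []. Qed.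

End ComplexModulus.

Section DiskIntegral.
Context {R : realType}.
Implicit Types (f g h F G : R[i] -> R[i]).

Definition cmeas f :=
  measurable_fun disk2 (fun p => complex.Re (f (@toC R p))) /\
  measurable_fun disk2 (fun p => complex.Im (f (@toC R p))).

Definition cintegrable F :=
  (@dA R).-integrable disk2 (fun p => (complex.Re (F (toC p)))%:E) /\
  (@dA R).-integrable disk2 (fun p => (complex.Im (F (toC p)))%:E).

Lemma cmeas_cst (c : R[i]) : cmeas (fun=> c).
Proof. by split; exact: measurable_cst. Qed.

Lemma cmeasD f g : cmeas f -> cmeas g -> cmeas (fun z => f z + g z).
Proof.
move=> [f1 f2] [g1 g2]; split.
- by under eq_fun do rewrite raddfD /=; exact: measurable_funD.
- by under eq_fun do rewrite raddfD /=; exact: measurable_funD.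
Qed.

Lemma cmeasM f g : cmeas f -> cmeas g -> cmeas (fun z => f z * g z).
Proof.
move=> [f1 f2] [g1 g2]; split.
- have -> : (fun p => complex.Re (f (toC p) * g (toC p))) =
    (fun p => complex.Re (f (toC p)) * complex.Re (g (toC p))) \-
    (fun p => complex.Im (f (toC p)) * complex.Im (g (toC p))).
    by apply/funext => p /=; case: (f _) => a b; case: (g _).
  by apply: measurable_funB; exact: measurable_funM.
- have -> : (fun p => complex.Im (f (toC p) * g (toC p))) =
    (fun p => complex.Re (f (toC p)) * complex.Im (g (toC p))) \+
    (fun p => complex.Im (f (toC p)) * complex.Re (g (toC p))).
    by apply/funext => p /=; case: (f _) => a b; case: (g _) => c d/=; ring.
  by apply: measurable_funD; exact: measurable_funM.
Qed.

Lemma cmeas_conj f : cmeas f -> cmeas (fun z => (f z)^*%C).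
Proof.
move=> [f1 f2]; split.
- by rewrite (_ : (fun p => _) = fun p => complex.Re (f (toC p)))//;
    apply/funext => p; case: (f _).
- rewrite (_ : (fun p => _) = fun p => - complex.Im (f (toC p))).
    exact: measurableT_comp.
  by apply/funext => p; case: (f _).
Qed.

Lemma cmeasB f g : cmeas f -> cmeas g -> cmeas (fun z => f z - g z).
Proof.
move=> mf mg; have := cmeasD mf (cmeasM (cmeas_cst (-1)) mg).
by under eq_fun do rewrite mulN1r.
Qed.

Lemma cmeasX f n : cmeas f -> cmeas (fun z => f z ^+ n).
Proof.
move=> mf; elim: n => [|n ih]; first exact: cmeas_cst.
by under eq_fun do rewrite exprS; exact: cmeasM.
Qed.

Lemma cmeas_id : cmeas id.
Proof.
by split; apply: measurable_funTS; [exact: measurable_fst|exact: measurable_snd].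
Qed.

Lemma measurable_normc f : cmeas f ->
  measurable_fun disk2 (fun p => normc (f (toC p))).
Proof.
move=> [f1 f2].
have -> : (fun p => normc (f (@toC R p))) = (fun p => Num.sqrt
  (complex.Re (f (toC p)) ^+ 2 + complex.Im (f (toC p)) ^+ 2)).
  by apply/funext => p; rewrite -normc2E sqrtr_sqr ger0_norm ?normc_ge0.
apply: (measurableT_comp (continuous_measurable_fun (@sqrt_continuous R))).
by apply: measurable_funD; exact: measurable_funX.
Qed.

Lemma cintegrable_le F (k : measurableTypeR R * measurableTypeR R -> R) :
  cmeas F -> measurable_fun disk2 k ->
  (forall p, disk2 p -> normc (F (toC p)) <= k p) ->
  (\int[dA]_(p in disk2) (k p)%:E < +oo)%E -> cintegrable F.
Proof.
move=> [m1 m2] mk Fk koo.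
have H (u : measurableTypeR R * measurableTypeR R -> R) :
    measurable_fun disk2 u -> (forall p, disk2 p -> `|u p| <= k p) ->
    (@dA R).-integrable disk2 (fun p => (u p)%:E).
  move=> mu ule; apply/integrableP; split; first exact/measurable_EFinP.
  apply: le_lt_trans koo; apply: ge0_le_integral => //=.
  - exact: measurable_disk2.
  - by apply/measurable_EFinP; exact: measurableT_comp.
  - exact/measurable_EFinP.
split; apply: H => // p Dp; apply: le_trans (Fk _ Dp).
  exact: absRe_le_normc.
exact: absIm_le_normc.
Qed.

Lemma cintegrableD F G : cintegrable F -> cintegrable G ->
  cintegrable (fun z => F z + G z).
Proof.
move=> [f1 f2] [g1 g2]; split.
- have := integrableD (@measurable_disk2 R) f1 g1; congr (integrable _ _ _).
  by apply/funext => p /=; rewrite raddfD.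
- have := integrableD (@measurable_disk2 R) f2 g2; congr (integrable _ _ _).
  by apply/funext => p /=; rewrite raddfD.
Qed.

Lemma cintegralD F G : cintegrable F -> cintegrable G ->
  cintegral (fun z => F z + G z) = cintegral F + cintegral G.
Proof.
move=> [f1 f2] [g1 g2]; rewrite /cintegral complexD.
by congr Complex; under eq_Rintegral do rewrite raddfD/=;
  rewrite RintegralD//; exact: measurable_disk2.
Qed.

Lemma cintegrableZ (c : R[i]) F : cintegrable F ->
  cintegrable (fun z => c * F z).
Proof.
move=> [f1 f2]; case: c => a b; split.
- have := integrableB (@measurable_disk2 R)
    (integrableZl (@measurable_disk2 R) a f1) (integrableZl (@measurable_disk2 R) b f2).
  by congr (integrable _ _ _); apply/funext => p /=; case: (F _).
- have := integrableD (@measurable_disk2 R)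
    (integrableZl (@measurable_disk2 R) a f2) (integrableZl (@measurable_disk2 R) b f1).
  by congr (integrable _ _ _); apply/funext => p /=; case: (F _).
Qed.

Lemma cintegralZ (c : R[i]) F : cintegrable F ->
  cintegral (fun z => c * F z) = c * cintegral F.
Proof.
move=> [f1 f2]; case: c => a b.
rewrite /cintegral -[RHS]/(Complex _ _).
have D := @measurable_disk2 R.
have I (k : R) u : (@dA R).-integrable disk2 (EFin \o u) ->
    (@dA R).-integrable disk2 (EFin \o (fun p => k * u p)).
  by move=> iu; exact: (integrableZl D k iu).
congr Complex.
- rewrite -(RintegralZl a D f1) -(RintegralZl b D f2) -RintegralB//.
  + by apply: eq_Rintegral => p _; case: (F _).
  + exact: I.
  + exact: I.
- rewrite -(RintegralZl a D f2) -(RintegralZl b D f1) -RintegralD//.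
  + by apply: eq_Rintegral => p _; case: (F _).
  + exact: I.
  + exact: I.
Qed.

Lemma cintegral_conj F : cintegrable F ->
  cintegral (fun z => (F z)^*%C) = (cintegral F)^*%C.
Proof.
move=> [f1 f2]; rewrite /cintegral/=; congr Complex.
  by apply: eq_Rintegral => p _; case: (F _).
rewrite -[RHS]mulN1r -RintegralZl//; last exact: measurable_disk2.
by apply: eq_Rintegral => p _; rewrite mulN1r; case: (F _).
Qed.

Lemma eq_cintegral F G : (forall z, disk z -> F z = G z) ->
  cintegral F = cintegral G.
Proof.
by move=> FG; rewrite /cintegral; congr Complex; apply: eq_Rintegral => p;
  rewrite inE => Dp; rewrite FG.
Qed.

End DiskIntegral.

(** * The inner product and the squared norm of L^2 *)

Section L2.
Context {R : realType}.
Implicit Types (f g h k : R[i] -> R[i]) (c : R[i]).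

Definition nrm2 f : R := complex.Re (dotL2 f f).

Lemma L2_cmeas f : L2 f -> cmeas f. Proof. by case. Qed.

Lemma normcM_le f g z : normc (f z * (g z)^*%C) <= normc (f z) ^+ 2 + normc (g z) ^+ 2.
Proof.
rewrite normcM normc_conj; have := sqr_ge0 (normc (f z) - normc (g z)).
have := sqr_ge0 (normc (f z) + normc (g z)); nra.
Qed.

Lemma L2_dot f g : L2 f -> L2 g -> cintegrable (fun z => f z * (g z)^*%C).
Proof.
move=> Lf Lg; have mf := L2_cmeas Lf; have mg := L2_cmeas Lg.
apply: (@cintegrable_le _ _
  (fun p => normc (f (toC p)) ^+ 2 + normc (g (toC p)) ^+ 2)).
- by apply: cmeasM => //; exact: cmeas_conj.
- by apply: measurable_funD; apply: measurable_funX; exact: measurable_normc.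
- by move=> p _; exact: normcM_le.
- rewrite (eq_integral (fun p => (normc (f (toC p)) ^+ 2)%:E +
    (normc (g (toC p)) ^+ 2)%:E)%E) => [|p _]; last by rewrite EFinD.
  rewrite ge0_integralD//=.
  + by apply: lte_add_pinfty; [case: Lf|case: Lg].
  + exact: measurable_disk2.
  + by move=> p _; rewrite lee_fin sqr_ge0.
  + exact: measurable_normc2.
  + by move=> p _; rewrite lee_fin sqr_ge0.
  + exact: measurable_normc2.
Qed.

Lemma dotL2Dl f g k : L2 f -> L2 g -> L2 k ->
  dotL2 (fun z => f z + g z) k = dotL2 f k + dotL2 g k.
Proof.
move=> Lf Lg Lk; rewrite /dotL2 -cintegralD//; [|exact: L2_dot|exact: L2_dot].
by apply: eq_cintegral => z _; rewrite mulrDl.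
Qed.

Lemma dotL2Zl c f k : L2 f -> L2 k ->
  dotL2 (fun z => c * f z) k = c * dotL2 f k.
Proof.
move=> Lf Lk; rewrite /dotL2 -cintegralZ//; last exact: L2_dot.
by apply: eq_cintegral => z _; rewrite mulrA.
Qed.

Lemma dotL2C f g : L2 f -> L2 g -> dotL2 g f = (dotL2 f g)^*%C.
Proof.
move=> Lf Lg; rewrite /dotL2 -cintegral_conj//; last exact: L2_dot.
by apply: eq_cintegral => z _; rewrite rmorphM /= conjcK mulrC.
Qed.

Lemma eq_dotL2 f g f' g' : (forall z, disk z -> f z = f' z) ->
  (forall z, disk z -> g z = g' z) -> dotL2 f g = dotL2 f' g'.
Proof. by move=> ff gg; apply: eq_cintegral => z Dz; rewrite ff// gg. Qed.

Lemma L2_add f g : L2 f -> L2 g -> L2 (fun z => f z + g z).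
Proof. by move=> Lf Lg; exact: (L2D Lf Lg). Qed.

Lemma L2_scale c f : L2 f -> L2 (fun z => c * f z).
Proof. by move=> Lf; exact: (@L2Z _ c _ Lf). Qed.

Lemma L2_opp f : L2 f -> L2 (fun z => - f z).
Proof.
by move=> Lf; rewrite (_ : (fun=> _) = fun z => -1 * f z); [exact: L2_scale|
  apply/funext => z; rewrite mulN1r].
Qed.

Lemma L2_sub f g : L2 f -> L2 g -> L2 (fun z => f z - g z).
Proof. by move=> Lf Lg; apply: L2_add => //; exact: L2_opp. Qed.

Lemma dotL2Nl f k : L2 f -> L2 k -> dotL2 (fun z => - f z) k = - dotL2 f k.
Proof.
move=> Lf Lk; rewrite -mulN1r -dotL2Zl//.
by apply: eq_dotL2 => // z _; rewrite mulN1r.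
Qed.

Lemma dotL2Bl f g k : L2 f -> L2 g -> L2 k ->
  dotL2 (fun z => f z - g z) k = dotL2 f k - dotL2 g k.
Proof. by move=> Lf Lg Lk; rewrite dotL2Dl ?dotL2Nl//; exact: L2_opp. Qed.

Lemma dotL2Dr f g k : L2 f -> L2 g -> L2 k ->
  dotL2 k (fun z => f z + g z) = dotL2 k f + dotL2 k g.
Proof.
move=> Lf Lg Lk; rewrite dotL2C ?dotL2Dl//; last exact: L2_add.
by rewrite rmorphD /= (dotL2C Lf Lk) (dotL2C Lg Lk).
Qed.

Lemma dotL2Zr c f k : L2 f -> L2 k ->
  dotL2 k (fun z => c * f z) = c^*%C * dotL2 k f.
Proof.
move=> Lf Lk; rewrite dotL2C ?dotL2Zl//; last exact: L2_scale.
by rewrite rmorphM /= (dotL2C Lf Lk).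
Qed.

Lemma dotL2Br f g k : L2 f -> L2 g -> L2 k ->
  dotL2 k (fun z => f z - g z) = dotL2 k f - dotL2 k g.
Proof.
move=> Lf Lg Lk; rewrite dotL2C ?dotL2Bl//; last exact: L2_sub.
by rewrite rmorphB /= (dotL2C Lf Lk) (dotL2C Lg Lk).
Qed.

Lemma nrm2E f : nrm2 f = (\int[dA]_(p in disk2) (normc (f (toC p)) ^+ 2)).
Proof. by apply: eq_Rintegral => p _; rewrite mulcJ. Qed.

Lemma nrm2_ge0 f : 0 <= nrm2 f.
Proof. by rewrite nrm2E; apply: Rintegral_ge0 => p _; rewrite sqr_ge0. Qed.

Lemma nrm2_EFin f : L2 f ->
  ((nrm2 f)%:E = \int[dA]_(p in disk2) (normc (f (toC p)) ^+ 2)%:E)%E.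
Proof.
move=> [_ _ foo]; rewrite nrm2E fineK// ge0_fin_numE//.
by apply: integral_ge0 => p _; rewrite lee_fin sqr_ge0.
Qed.

Lemma dotL2_nrm2 f : L2 f -> dotL2 f f = (nrm2 f)%:C.
Proof.
move=> Lf; rewrite [LHS](_ : _ = (complex.Re (dotL2 f f)) +i* complex.Im (dotL2 f f));
  last by case: (dotL2 f f).
congr Complex; have := dotL2C Lf Lf; case: (dotL2 f f) => a b [] /= bN.
by lra.
Qed.

Lemma eq_nrm2 f g : (forall z, disk z -> f z = g z) -> nrm2 f = nrm2 g.
Proof. by move=> fg; rewrite /nrm2 (eq_dotL2 fg fg). Qed.

Lemma nrm2Z c f : L2 f -> nrm2 (fun z => c * f z) = normc c ^+ 2 * nrm2 f.
Proof.
move=> Lf; have Lc := @L2_scale c _ Lf.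
rewrite /nrm2 dotL2Zl// dotL2Zr// mulrA mulcJ dotL2_nrm2//.
by rewrite /= mul0r subr0.
Qed.

Lemma nrm2B f g : L2 f -> L2 g -> nrm2 (fun z => f z - g z) =
  nrm2 f + nrm2 g - 2 * complex.Re (dotL2 f g).
Proof.
move=> Lf Lg; have Lfg := L2_sub Lf Lg.
rewrite /nrm2 dotL2Bl// !dotL2Br// (dotL2C Lf Lg) !raddfB/=.
by case: (dotL2 f g) => a b /=; ring.
Qed.

Lemma nrm2D f g : L2 f -> L2 g -> nrm2 (fun z => f z + g z) =
  nrm2 f + nrm2 g + 2 * complex.Re (dotL2 f g).
Proof.
move=> Lf Lg; have Lfg := L2_add Lf Lg.
rewrite /nrm2 dotL2Dl// !dotL2Dr// (dotL2C Lf Lg) !raddfD/=.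
by case: (dotL2 f g) => a b /=; ring.
Qed.

(** The form is only semidefinite on functions, so the discriminant argument treats [nrm2 g = 0]
    separately. *)
Lemma cauchy_schwarz f g : L2 f -> L2 g ->
  normc (dotL2 f g) ^+ 2 <= nrm2 f * nrm2 g.
Proof.
move=> Lf Lg; set d := dotL2 f g; set D := normc d ^+ 2.
(* Expands the squared norm of [f - t d g]: the factor [d] makes the cross term the real number
   [t * D]. *)
have key (t : R) : 0 <= nrm2 f - 2 * t * D + t ^+ 2 * D * nrm2 g.
  have := nrm2_ge0 (fun z => f z - (t%:C * d) * g z).
  have Lc := @L2_scale (t%:C * d) _ Lg.
  rewrite nrm2B// nrm2Z// dotL2Zr// -/d normcM normc_real exprMn real_normK ?num_real//.
  have -> : complex.Re ((t%:C * d)^*%C * d) = t * D.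
    by rewrite /D normc2E; case: (d) => a b /=; ring.
  rewrite -/D => h.
  by apply: le_trans h _; rewrite le_eqVlt; apply/orP; left; apply/eqP; ring.
have f0 := nrm2_ge0 f; have := nrm2_ge0 g.
have D0 : 0 <= D by rewrite sqr_ge0.
rewrite le_eqVlt => /predU1P[g0|g0].
  rewrite -g0 mulr0 leNgt; apply/negP => Dp.
  (* Without a quadratic term this [t] makes the value [nrm2 f - 2 * (nrm2 f + 1)], which is
     negative. *)
  have := key ((nrm2 f + 1) / D); rewrite -g0 mulr0 addr0 -mulrA divfK ?gt_eqF//.
  lra.
have := key (nrm2 g)^-1.
rewrite (_ : nrm2 f - _ + _ = nrm2 f - D / nrm2 g); last first.
  by field; rewrite gt_eqF.
by rewrite subr_ge0 ler_pdivrMr.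
Qed.

Lemma nrm2D_le f g : L2 f -> L2 g ->
  nrm2 (fun z => f z + g z) <= 2 * (nrm2 f + nrm2 g).
Proof.
move=> Lf Lg; have := nrm2_ge0 (fun z => f z - g z).
rewrite nrm2B// nrm2D//; lra.
Qed.

Lemma L2_bound f g (M : R) : cmeas g -> L2 f ->
  (forall z, disk z -> normc (g z) <= M * normc (f z)) ->
  L2 g /\ nrm2 g <= M ^+ 2 * nrm2 f.
Proof.
move=> [m1 m2] Lf gf.
have h : (\int[dA]_(p in disk2) (normc (g (toC p)) ^+ 2)%:E <=
  (M ^+ 2 * nrm2 f)%:E)%E.
  rewrite EFinM nrm2_EFin// -ge0_integralZl_EFin//=.
  - apply: ge0_le_integral => //=.
    + exact: measurable_disk2.
    + by move=> p _; rewrite lee_fin sqr_ge0.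
    + apply/measurable_EFinP; apply: measurable_funX; exact: measurable_normc.
    + apply: measurable_funeM; exact: measurable_normc2.
    + move=> p Dp; rewrite -EFinM lee_fin -exprMn lerXn2r ?nnegrE ?normc_ge0//.
        by rewrite (le_trans _ (gf _ Dp))// normc_ge0.
      exact: gf.
  - exact: measurable_disk2.
  - by move=> p _; rewrite lee_fin sqr_ge0.
  - exact: measurable_normc2.
  - by rewrite sqr_ge0.
have Lg : L2 g by split=> //; apply: le_lt_trans h _; rewrite ltry.
by split=> //; rewrite -lee_fin nrm2_EFin.
Qed.

End L2.

(** * Strict differentiability *)

Section StrictDifferentiability.
Context {R : realType}.
Implicit Types (G H : R[i] -> R[i]) (z w a b h p q : R[i]) (e : R).

(** Both points move, as strict differentiability requires; ordinary differentiability would keep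
    [b = z]. *)
Definition near2 z (P : R[i] -> R[i] -> Prop) := exists2 d : R, 0 < d &
  forall a b, normc (a - z) < d -> normc (b - z) < d -> P a b.

(** The real-linear map sending 1 to [p] and ['i] to [q]. It is complex-linear exactly when
    [q = 'i * p]. *)
Definition lin p q h : R[i] := p * (complex.Re h)%:C + q * (complex.Im h)%:C.

(* Strict differentiability in the real sense, with partial derivatives [p] and
   [q]. When it holds at every point, [p] and [q] are automatically continuous
   (see [sdiff_near_p]). *)
Definition sdiff G z p q := forall e, 0 < e ->
  near2 z (fun a b => normc (G a - G b - lin p q (a - b)) <= e * normc (a - b)).

Lemma near2_and z P Q : near2 z P -> near2 z Q ->
  near2 z (fun a b => P a b /\ Q a b).
Proof.
move=> [d d0 dP] [d' d'0 dQ]; exists (Num.min d d'); first by rewrite lt_min d0.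
by move=> a b; rewrite !lt_min => /andP[a1 a2] /andP[b1 b2]; split;
  [exact: dP|exact: dQ].
Qed.

Lemma near2_sub z (P Q : R[i] -> R[i] -> Prop) : (forall a b, P a b -> Q a b) ->
  near2 z P -> near2 z Q.
Proof. by move=> PQ [d d0 dP]; exists d => // a b az bz; apply/PQ/dP. Qed.

Lemma lin_le p q h : normc (lin p q h) <= (normc p + normc q) * normc h.
Proof.
apply: le_trans (le_normcD _ _) _; rewrite !normcM !normc_real mulrDl.
by apply: lerD; apply: ler_wpM2l; rewrite ?normc_ge0 ?absRe_le_normc ?absIm_le_normc.
Qed.

Lemma linD p q p' q' h : lin (p + p') (q + q') h = lin p q h + lin p' q' h.
Proof. by rewrite /lin; ring. Qed.

Lemma linZ c p q h : lin (c * p) (c * q) h = c * lin p q h.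
Proof. by rewrite /lin; ring. Qed.

Lemma lin_id h : lin 1 'i h = h.
Proof.
case: h => a b; rewrite /lin; apply/eqP; rewrite eq_complex /=.
by apply/andP; split; apply/eqP; ring.
Qed.

Lemma sdiff_lip G z p q : sdiff G z p q -> near2 z
  (fun a b => normc (G a - G b) <= (1 + normc p + normc q) * normc (a - b)).
Proof.
move=> /(_ _ ltr01); apply: near2_sub => a b; rewrite mul1r => ab.
have := le_normcD (G a - G b - lin p q (a - b)) (lin p q (a - b)).
rewrite subrK => /le_trans; apply; rewrite -(addrA 1) mulrDl mul1r.
by apply: lerD => //; exact: lin_le.
Qed.

Lemma sdiff_cont G z p q e : sdiff G z p q -> 0 < e ->
  near2 z (fun a b => normc (G a - G z) <= e /\ normc (G b - G z) <= e).
Proof.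
move=> /sdiff_lip [d d0 dG] e0; set K := 1 + _ + _ in dG.
have K0 : 0 < K by rewrite /K -addrA ltr_pwDl// addr_ge0// normc_ge0.
exists (Num.min d (e / K)); first by rewrite lt_min d0 divr_gt0.
have zz : normc (z - z) < d by rewrite subrr normc0.
move=> a b; rewrite !lt_min => /andP[a1 a2] /andP[b1 b2].
by split; (apply: le_trans (dG _ _ _ zz) _ => //);
  rewrite mulrC -ler_pdivlMr// ltW.
Qed.

Lemma sdiff_eq G H z p q (d : R) : 0 < d ->
  (forall w, normc (w - z) < d -> G w = H w) -> sdiff G z p q -> sdiff H z p q.
Proof.
move=> d0 GH sG e e0; have [d' d'0 dG] := sG e e0.
exists (Num.min d d'); first by rewrite lt_min d0.
move=> a b; rewrite !lt_min => /andP[a1 a2] /andP[b1 b2].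
by rewrite -!GH//; exact: dG.
Qed.

Lemma sdiff_cst c z : sdiff (fun=> c) z 0 0.
Proof.
move=> e e0; exists 1 => // a b _ _.
by rewrite /lin !mul0r !subrr addr0 subr0 normc0 mulr_ge0 ?normc_ge0// ltW.
Qed.

Lemma sdiff_id z : sdiff id z 1 'i.
Proof.
move=> e e0; exists 1 => // a b _ _.
by rewrite lin_id subrr normc0 mulr_ge0 ?normc_ge0// ltW.
Qed.

Lemma sdiff_conj z : sdiff (fun w => w^*%C) z 1 (- 'i).
Proof.
move=> e e0; exists 1 => // a b _ _.
have -> : lin 1 (- 'i) (a - b) = a^*%C - b^*%C.
  rewrite -rmorphB /=; case: (a - b) => x y; rewrite /lin; apply/eqP.
  by rewrite eq_complex /=; apply/andP; split; apply/eqP; ring.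
by rewrite subrr normc0 mulr_ge0 ?normc_ge0// ltW.
Qed.

Lemma sdiffD G H z p q p' q' : sdiff G z p q -> sdiff H z p' q' ->
  sdiff (fun w => G w + H w) z (p + p') (q + q').
Proof.
move=> sG sH e e0; have e2 : 0 < e / 2 by rewrite divr_gt0.
apply: near2_sub (near2_and (sG _ e2) (sH _ e2)) => a b [ha hb].
rewrite linD [X in normc X](_ : _ = (G a - G b - lin p q (a - b)) +
  (H a - H b - lin p' q' (a - b))); last by ring.
apply: le_trans (le_normcD _ _) _; apply: le_trans (lerD ha hb) _.
by rewrite -mulrDl -splitr.
Qed.

Lemma sdiffM G H z p q p' q' : sdiff G z p q -> sdiff H z p' q' ->
  sdiff (fun w => G w * H w) z (p * H z + G z * p') (q * H z + G z * q').
Proof.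
move=> sG sH e e0.
set M := 1 + normc (G z) + normc (H z).
set L := normc p + normc q + normc p' + normc q'.
have n0 := @normc_ge0 R.
have M0 : 1 <= M by rewrite /M; have := n0 (G z); have := n0 (H z); lra.
have L0 : 0 <= L by rewrite /L !addr_ge0.
(* The four error terms below have sizes [k * M], [M * k], [L * k] and [k * L], with sum [e]. The
   cap at 1 in [k1] keeps [H a] and [G b] below [M]. *)
pose k := e / (2 * (M + L)).
have k0 : 0 < k by rewrite divr_gt0// mulr_gt0//; lra.
pose k1 := Num.min k 1.
have k10 : 0 < k1 by rewrite lt_min k0 ltr01.
have := near2_and (near2_and (sG _ k0) (sH _ k0))
  (near2_and (sdiff_cont sG k10) (sdiff_cont sH k10)).
apply: near2_sub => a b [[hG hH] [[_ Gb] [Ha _]]].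
set N := normc (a - b) in hG hH *.
have N0 : 0 <= N by exact: n0.
move: Gb Ha; rewrite /k1 !le_min => /andP[Gbk Gb1] /andP[Hak Ha1].
rewrite [X in normc X](_ : _ = (G a - G b - lin p q (a - b)) * H a +
   G b * (H a - H b - lin p' q' (a - b)) + (lin p q (a - b) * (H a - H z) +
   (G b - G z) * lin p' q' (a - b))); last by rewrite /lin; ring.
have HaM : normc (H a) <= M.
  by rewrite -(subrK (H z) (H a)) (le_trans (le_normcD _ _))// /M;
    have := n0 (G z); lra.
have GbM : normc (G b) <= M.
  by rewrite -(subrK (G z) (G b)) (le_trans (le_normcD _ _))// /M;
    have := n0 (H z); lra.
have l1 : normc (lin p q (a - b)) <= L * N.
  by apply: le_trans (lin_le _ _ _) _; rewrite ler_wpM2r// /L;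
    have := n0 p'; have := n0 q'; lra.
have l2 : normc (lin p' q' (a - b)) <= L * N.
  by apply: le_trans (lin_le _ _ _) _; rewrite ler_wpM2r// /L;
    have := n0 p; have := n0 q; lra.
have -> : e = k * M + M * k + (L * k + k * L).
  by rewrite /k; field; rewrite gt_eqF//; lra.
rewrite !(mulrDl _ _ N).
do 2 ?apply: le_trans (le_normcD _ _) _; apply: lerD.
  apply: le_trans (le_normcD _ _) _; rewrite !normcM; apply: lerD.
    by rewrite mulrAC; apply: ler_pM.
  by rewrite -mulrA; apply: ler_pM.
apply: le_trans (le_normcD _ _) _; rewrite !normcM; apply: lerD.
  by rewrite mulrAC; apply: ler_pM.
by rewrite -mulrA; apply: ler_pM.
Qed.

Lemma sdiffV G z p q : sdiff G z p q -> G z != 0 ->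
  sdiff (fun w => (G w)^-1) z (- (G z) ^- 2 * p) (- (G z) ^- 2 * q).
Proof.
move=> sG Gz0 e e0.
have n0 := @normc_ge0 R.
set g := normc (G z).
have g0 : 0 < g by rewrite lt_def n0 andbT; apply/eqP => /normc_eq0P/eqP; exact/negP.
set L := 1 + normc p + normc q.
have L0 : 0 < L by rewrite /L -addrA ltr_pwDl// addr_ge0.
(* The bound [g / 2] keeps [G a] and [G b] at modulus at least [g / 2]. With the second bound the
   quadratic error is at most [L * N * (e * g ^+ 3 / (20 * L)) * (5 / 2 * g)] over [g ^+ 4 / 4],
   that is [e / 2 * N]. *)
pose k := Num.min (g / 2) (e * g ^+ 3 / (20 * L)).
have k0 : 0 < k by rewrite lt_min divr_gt0// divr_gt0// mulr_gt0// exprn_gt0.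
have j0 : 0 < e * g ^+ 2 / 2 by rewrite divr_gt0// mulr_gt0// exprn_gt0.
apply: near2_sub (near2_and (sG _ j0) (near2_and (sdiff_cont sG k0) (sdiff_lip sG))).
move=> a b [hG [[Ga Gb] hL]].
move: Ga Gb; rewrite /k !le_min => /andP[Ga1 Ga2] /andP[Gb1 Gb2].
have lo u : normc (u - G z) <= g / 2 -> g / 2 <= normc u.
  move=> hu; have := normc_subD (G z) u; rewrite normc_sym -/g => h.
  have := le_trans h hu; lra.
have Ga3 := lo _ Ga1; have Gb3 := lo _ Gb1.
have nz u : g / 2 <= normc u -> u != 0.
  by move=> hu; apply/eqP => u0; move: hu; rewrite u0 normc0; lra.
have Ga0 := nz _ Ga3; have Gb0 := nz _ Gb3.
have -> : (G a)^-1 - (G b)^-1 - lin (- (G z) ^- 2 * p) (- (G z) ^- 2 * q) (a - b) =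
  - (G z) ^- 2 * (G a - G b - lin p q (a - b)) +
  (G a - G b) * ((G a - G z) * G b + (G b - G z) * G z) / (G a * G b * G z ^+ 2).
  by rewrite linZ; field; rewrite ?Gz0 ?Ga0 ?Gb0.
apply: le_trans (le_normcD _ _) _.
set N := normc (a - b) in hG hL *.
have N0 : 0 <= N by exact: n0.
rewrite [leRHS](_ : _ = e / 2 * N + e / 2 * N); last by rewrite -mulrDl -splitr.
apply: lerD.
  rewrite normcM normcN normcV normcX -/g mulrC ler_pdivrMr ?exprn_gt0//.
  by apply: le_trans hG _; rewrite le_eqVlt; apply/orP; left; apply/eqP; field.
rewrite [normc (_ / _)]normcM normcV [normc (_ * G z ^+ 2)]normcM normcX -/g (normcM (G a) (G b)) [normc ((G a - _) * _)]normcM.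
have Gb4 : normc (G b) <= 3 / 2 * g.
  by rewrite -(subrK (G z) (G b)) (le_trans (le_normcD _ _))// -/g; lra.
have num : normc ((G a - G z) * G b + (G b - G z) * G z) <=
    e * g ^+ 3 / (20 * L) * (5 / 2 * g).
  rewrite (_ : 5 / 2 * g = 3 / 2 * g + g); last by field.
  rewrite mulrDr; apply: le_trans (le_normcD _ _) _; rewrite !normcM.
  by apply: lerD; apply: ler_pM.
have den : g / 2 * (g / 2) * g ^+ 2 <= normc (G a) * normc (G b) * g ^+ 2.
  by rewrite ler_wpM2r ?sqr_ge0// ler_pM// divr_ge0// ltW.
have den0 : 0 < g / 2 * (g / 2) * g ^+ 2 by rewrite !mulr_gt0 ?exprn_gt0.
rewrite ler_pdivrMr; last exact: lt_le_trans den.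
apply: le_trans (ler_pM _ _ hL num) _ => //.
apply: (@le_trans _ _ (e / 2 * N * (g / 2 * (g / 2) * g ^+ 2))).
  rewrite le_eqVlt; apply/orP; left; apply/eqP; rewrite -/L; field.
  by rewrite gt_eqF.
by apply: ler_wpM2l => //; rewrite mulr_ge0// divr_ge0// ltW.
Qed.

Lemma sdiff_uniq G z p q p' q' : sdiff G z p q -> sdiff G z p' q' ->
  p = p' /\ q = q'.
Proof.
move=> sG sG'.
have key h : normc h = 1 -> lin (p - p') (q - q') h = 0.
  move=> h1; apply/normc_eq0P/eqP; rewrite eq_le normc_ge0 andbT.
  apply/ler_addgt0Pl => e e0; rewrite addr0.
  have e2 : 0 < e / 2 by rewrite divr_gt0.
  have [d d0 dG] := near2_and (sG _ e2) (sG' _ e2).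
  pose t := d / 2; have t0 : 0 < t by rewrite divr_gt0.
  have E : z + t%:C * h - z = t%:C * h by rewrite addrC addKr.
  have [] := dG (z + t%:C * h) z.
  - rewrite E normcM h1 normc_real mulr1 gtr0_norm// /t; lra.
  - by rewrite subrr normc0.
  have linR u v : lin u v (t%:C * h) = t%:C * lin u v h.
    rewrite /lin (_ : complex.Re _ = t * complex.Re h); last first.
      by case: (h) => x y /=; ring.
    rewrite (_ : complex.Im (t%:C * h) = t * complex.Im h); last first.
      by case: (h) => x y /=; ring.
    by rewrite !rmorphM/=; ring.
  rewrite E !linR normcM normc_real h1 mulr1 gtr0_norm// => A B.
  have : normc (t%:C * lin (p - p') (q - q') h) <= e * t.
    rewrite [X in normc X](_ : _ = (G (z + t%:C * h) - G z - t%:C * lin p' q' h) -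
       (G (z + t%:C * h) - G z - t%:C * lin p q h)); last by rewrite /lin; ring.
    apply: le_trans (le_normcD _ _) _; rewrite normcN.
    by apply: le_trans (lerD B A) _; rewrite -mulrDl -splitr.
  by rewrite normcM normc_real gtr0_norm// mulrC ler_pM2r.
split; apply/eqP; rewrite -subr_eq0; apply/eqP.
- have := key 1; rewrite normc1 => /(_ erefl).
  by rewrite /lin /= mulr1 mulr0 addr0.
- have := key 'i; rewrite /= expr0n expr1n add0r sqrtr1 => /(_ erefl).
  by rewrite /lin /= mulr1 mulr0 add0r.
Qed.

(** Near [w], one and the same increment of [G] is approximated by the differential at [w] and also
    by the one at [z], whose estimate covers every pair close to [z]. The two differentials are
    therefore close on unit vectors. *)
Lemma sdiff_near_p G (P Q : R[i] -> R[i]) z (r : R) : 0 < r ->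
  (forall w, normc (w - z) < r -> sdiff G w (P w) (Q w)) ->
  forall e, 0 < e -> exists2 d, 0 < d &
    forall w, normc (w - z) < d -> normc (P w - P z) <= e /\ normc (Q w - Q z) <= e.
Proof.
move=> r0 sG e e0; have e2 : 0 < e / 2 by rewrite divr_gt0.
have [] := sG z _ _ e2; first by rewrite subrr normc0.
move=> d d0 dG; exists (Num.min r d); first by rewrite lt_min r0.
move=> w; rewrite lt_min => /andP[wr wd].
have [d' d'0 dG'] := sG w wr _ e2.
(* Small enough for [w + t h] to stay within [d'] of [w] and within [d] of [z]. *)
pose t := Num.min d' (d - normc (w - z)) / 2.
have m0 : 0 < Num.min d' (d - normc (w - z)) by rewrite lt_min d'0 subr_gt0.
have t0 : 0 < t by rewrite divr_gt0.
have tm : t < Num.min d' (d - normc (w - z)) by rewrite /t; lra.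
move: tm; rewrite lt_min => /andP[t1 t2].
have key h : normc h = 1 ->
    normc (lin (P w) (Q w) h - lin (P z) (Q z) h) <= e.
  move=> h1.
  have E : w + t%:C * h - w = t%:C * h by rewrite addrC addKr.
  have nE : normc (w + t%:C * h - w) = t.
    by rewrite E normcM h1 normc_real mulr1 gtr0_norm.
  have A := dG' (w + t%:C * h) w; rewrite nE subrr normc0 in A.
  have {}A := A t1 d'0.
  have wz : normc (w + t%:C * h - z) < d.
    by apply: le_lt_trans (normc_dist_trans w _ _) _; rewrite nE; lra.
  have := dG _ _ wz wd; rewrite nE => B.
  have linR u v : lin u v (t%:C * h) = t%:C * lin u v h.
    rewrite /lin (_ : complex.Re _ = t * complex.Re h); last first.
      by case: (h) => x y /=; ring.
    rewrite (_ : complex.Im (t%:C * h) = t * complex.Im h); last first.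
      by case: (h) => x y /=; ring.
    by rewrite !rmorphM/=; ring.
  rewrite E !linR in A B.
  have : normc (t%:C * (lin (P w) (Q w) h - lin (P z) (Q z) h)) <= e * t.
    rewrite [X in normc X](_ : _ =
      (G (w + t%:C * h) - G w - t%:C * lin (P z) (Q z) h) -
      (G (w + t%:C * h) - G w - t%:C * lin (P w) (Q w) h)); last by ring.
    apply: le_trans (le_normcD _ _) _; rewrite normcN.
    by apply: le_trans (lerD B A) _; rewrite -mulrDl -splitr.
  by rewrite normcM normc_real gtr0_norm// mulrC ler_pM2r.
split.
- have := key 1; rewrite normc1 => /(_ erefl).
  by rewrite /lin /= !mulr1 !mulr0 !addr0.
- have := key 'i; rewrite /= expr0n expr1n add0r sqrtr1 => /(_ erefl).
  by rewrite /lin /= !mulr1 !mulr0 !add0r.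
Qed.

End StrictDifferentiability.

(** * Power series *)

Section PowerSeries.
Context {R : realType}.
Implicit Types (a : nat -> R[i]) (F f : R[i] -> R[i]) (r : R) (z w u v : R[i]).

Definition powser a F r := forall u, normc u < r -> forall e : R, 0 < e ->
  exists N, forall n, (N <= n)%N ->
    normc (F u - \sum_(k < n) a k * u ^+ k) <= e.

Lemma series_powserE a u (n : nat) :
  series (fun n => a n * u ^+ n : R[i]^o) n = \sum_(k < n) a k * u ^+ k.
Proof. by rewrite /series /= big_mkord. Qed.

Lemma analytic_powser f : analytic f <-> forall z, disk z ->
  exists a r, 0 < r /\ powser a (fun u => f (z + u)) r.
Proof.
split=> af z Dz; have [a [r [r0 h]]] := af z Dz; exists a, r; split=> //.
- move=> u ur e e0.
  have uE : z + u - z = u by rewrite addrC addKr.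
  have := h (z + u); rewrite uE; move=> /(_ _)/cvgrPdist_le.
  rewrite -[`|u|]/((normc u)%:C) ltcR => /(_ ur e%:C); rewrite ltcR => /(_ e0).
  move=> [N _ hN]; exists N => n Nn; have := hN n Nn.
  by rewrite /= series_powserE -[`|_ : R[i]^o|]/((normc _)%:C) lecR.
- move=> w; rewrite -[`|_|]/((normc _)%:C) ltcR => wz.
  apply/cvgrPdist_le => e; rewrite ltcE /= => /andP[/eqP ime e0].
  have [N hN] := h _ wz _ e0; exists N => // n Nn /=.
  rewrite series_powserE -[`|_ : R[i]^o|]/((normc _)%:C).
  have -> : e = (complex.Re e)%:C by move: ime; case: (e) => x y /= ->.
  by rewrite lecR; have := hN n Nn; rewrite addrCA subrr addr0.
Qed.

(** Convergence at the single point [r / 2] suffices: from some index on, a term is the difference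
    of two errors of size at most 1, and each earlier term is bounded by the sum of all of them. *)
Lemma powser_coef_bound a F r : 0 < r -> powser a F r ->
  exists2 B, 0 < B & forall n, normc (a n) * (r / 2) ^+ n <= B.
Proof.
move=> r0 aF; have r2 : 0 < r / 2 by rewrite divr_gt0.
have [|N hN] := aF (r / 2)%:C _ 1 ltr01.
  by rewrite normc_real gtr0_norm//; lra.
have term n : normc (a n * (r / 2)%:C ^+ n) = normc (a n) * (r / 2) ^+ n.
  by rewrite normcM normcX normc_real gtr0_norm.
exists (2 + \sum_(k < N) normc (a k) * (r / 2) ^+ k).
  rewrite ltr_pwDl// sumr_ge0// => i _.
  by rewrite mulr_ge0 ?normc_ge0// exprn_ge0// ltW.
move=> n; have [nN|Nn] := ltnP n N.
  rewrite (bigD1 (Ordinal nN))//= addrCA lerDl addr_ge0// sumr_ge0// => i _.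
  by rewrite mulr_ge0 ?normc_ge0// exprn_ge0// ltW.
rewrite -term; apply: (@le_trans _ _ 2); last first.
  rewrite lerDl sumr_ge0// => i _.
  by rewrite mulr_ge0 ?normc_ge0// exprn_ge0// ltW.
have := hN n Nn; have := hN n.+1 (leqW Nn); rewrite big_ord_recr /=.
set S := \sum_(_ < _) _; set t := a n * _ => h1 h2.
rewrite [X in normc X](_ : _ = (F (r / 2)%:C - S) - (F (r / 2)%:C - (S + t))); last by ring.
by apply: le_trans (le_normcD _ _) _; rewrite normcN; lra.
Qed.

Lemma normc_subX u v (rho : R) n : normc u <= rho -> normc v <= rho ->
  normc (u ^+ n.+1 - v ^+ n.+1) <= n.+1%:R * rho ^+ n * normc (u - v).
Proof.
move=> ur vr; have rho0 : 0 <= rho by apply: le_trans ur; exact: normc_ge0.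
elim: n => [|n ih]; first by rewrite !expr1 expr0 !mul1r.
rewrite [X in normc X](_ : _ = u * (u ^+ n.+1 - v ^+ n.+1) + (u - v) * v ^+ n.+1); last first.
  by rewrite [u ^+ n.+2]exprS [v ^+ n.+2]exprS; ring.
apply: le_trans (le_normcD _ _) _; rewrite !normcM.
apply: (@le_trans _ _ (rho * (n.+1%:R * rho ^+ n * normc (u - v)) +
   normc (u - v) * rho ^+ n.+1)).
  apply: lerD; first by apply: ler_pM => //; exact: normc_ge0.
  rewrite ler_wpM2l ?normc_ge0// normcX.
  by rewrite lerXn2r ?nnegrE ?normc_ge0.
rewrite le_eqVlt; apply/orP; left; apply/eqP.
have -> : n.+2%:R = n.+1%:R + 1 :> R by rewrite natr1.
by rewrite exprS; ring.
Qed.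

Lemma sum_half_le n : \sum_(k < n) (2^-1 : R) ^+ k <= 2.
Proof.
suff -> : \sum_(k < n) (2^-1 : R) ^+ k = 2 - 2 * 2^-1 ^+ n.
  by rewrite gerBl mulr_ge0// exprn_ge0// invr_ge0.
elim: n => [|n ih]; first by rewrite big_ord0 expr0; lra.
by rewrite big_ord_recr /= ih exprS; field.
Qed.

(** The constant term cancels in [F u - F v] and the linear one is exact. Each higher power is
    Lipschitz on the disk of radius [rho] with a small constant, so strict differentiability follows
    without differentiating the series term by term. *)
Lemma powser_sdiff a F r : 0 < r -> powser a F r ->
  sdiff F 0 (a 1%N) ('i * a 1%N).
Proof.
move=> r0 aF e e0; have [B B0 aB] := powser_coef_bound r0 aF.
(* With [rho <= r / 8], the factors [2 / r] from the coefficients, [r / 8] from the powers and 2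
   from [k.+2 <= 2 * 2 ^+ k] give ratio 1/2. The geometric sum is at most [16 * B * rho / r ^+ 2],
   which explains the second bound. *)
pose rho := Num.min (r / 8) (e * r ^+ 2 / (16 * B)).
have rho0 : 0 < rho.
  by rewrite lt_min !divr_gt0// ?mulr_gt0// ?exprn_gt0.
have rho8 : rho <= r / 8 by rewrite ge_min lexx.
have rhoe : rho <= e * r ^+ 2 / (16 * B) by rewrite ge_min lexx orbT.
exists rho => // u v; rewrite !subr0 => ur vr.
have linE : lin (a 1%N) ('i * a 1%N) (u - v) = a 1%N * (u - v).
  move: (u - v) => h; rewrite /lin [in RHS](complexE h) mulrDr.
  by rewrite mulrCA !mulrA.
rewrite linE.
have coef k : normc (a k.+2) * (k.+2%:R * rho ^+ k.+1) <=
    B * (2 / r) ^+ 2 * rho * 2 * 2^-1 ^+ k.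
  have r2 : 0 < (r / 2) ^+ k.+2 by rewrite exprn_gt0// divr_gt0.
  have h1 : normc (a k.+2) <= B * (2 / r) ^+ k.+2.
    rewrite -(invf_div r 2) exprVn ler_pdivlMr//; exact: aB.
  have h2 : (k.+2%:R : R) <= 2 * 2 ^+ k.
    rewrite -exprS -natrX ler_nat; exact: ltn_expl.
  apply: (@le_trans _ _ (B * (2 / r) ^+ k.+2 * (2 * 2 ^+ k * (rho * (r / 8) ^+ k)))).
    apply: ler_pM => //; first exact: normc_ge0.
      by rewrite mulr_ge0// exprn_ge0// ltW.
    apply: ler_pM => //; first by rewrite exprn_ge0// ltW.
    have r8 : 0 <= r / 8 by rewrite divr_ge0// ltW.
    by rewrite exprS ler_pM2l// lerXn2r ?nnegrE// ltW.
  rewrite le_eqVlt; apply/orP; left; apply/eqP.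
  have -> : (2 / r) ^+ k.+2 = (2 / r) ^+ 2 * (2 / r) ^+ k by rewrite -exprD.
  have -> : (r / 8) ^+ k = ((2 / r) ^+ k)^-1 * (4^-1) ^+ k.
    by rewrite -exprVn -exprMn; congr (_ ^+ k); field; rewrite gt_eqF.
  have -> : (4^-1 : R) ^+ k = 2^-1 ^+ k * 2^-1 ^+ k.
    by rewrite -exprMn; congr (_ ^+ k); field.
  have -> : (2 : R) ^+ k = (2^-1 ^+ k)^-1 by rewrite -exprVn invrK.
  field.
  by rewrite !expf_neq0 ?invr_eq0 ?mulf_neq0 ?invr_eq0 ?gt_eqF.
have Q0 : 0 <= B * (2 / r) ^+ 2 by rewrite mulr_ge0 ?sqr_ge0// ltW.
have part n : normc (\sum_(k < n.+2) a k * u ^+ k - \sum_(k < n.+2) a k * v ^+ k -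
    a 1%N * (u - v)) <= e * normc (u - v).
  have -> : \sum_(k < n.+2) a k * u ^+ k - \sum_(k < n.+2) a k * v ^+ k -
    a 1%N * (u - v) = \sum_(k < n) a k.+2 * (u ^+ k.+2 - v ^+ k.+2).
    rewrite !big_ord_recl /= !expr0 !mulr1 /bump /= !add1n !expr1.
    under [RHS]eq_bigr do rewrite mulrBr.
    rewrite sumrB.
    set X := \sum_(_ < _) _; set Y := \sum_(_ < _) _.
    by ring.
  apply: le_trans (normc_sum _ _ _) _.
  apply: (@le_trans _ _ (\sum_(k < n) B * (2 / r) ^+ 2 * rho * 2 * 2^-1 ^+ k *
     normc (u - v))).
    apply: ler_sum => i _; rewrite normcM.
    apply: (@le_trans _ _ (normc (a i.+2) * (i.+2%:R * rho ^+ i.+1 * normc (u - v)))).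
      apply: ler_wpM2l; first exact: normc_ge0.
      by apply: normc_subX; exact: ltW.
    by rewrite mulrA ler_wpM2r// normc_ge0.
  rewrite -mulr_suml ler_wpM2r ?normc_ge0// -mulr_sumr.
  apply: (@le_trans _ _ (B * (2 / r) ^+ 2 * rho * 2 * 2)).
    by apply: ler_wpM2l (sum_half_le n); do 2 apply: mulr_ge0 => //; exact: ltW.
  apply: (@le_trans _ _ (B * (2 / r) ^+ 2 * (e * r ^+ 2 / (16 * B)) * 2 * 2)).
    by rewrite !ler_pM2r// ler_wpM2l.
  rewrite le_eqVlt; apply/orP; left; apply/eqP; field.
  by rewrite !gt_eqF.
apply/ler_addgt0Pl => d d0; have d2 : 0 < d / 2 by rewrite divr_gt0.
have ur' : normc u < r by apply: lt_le_trans ur _; lra.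
have vr' : normc v < r by apply: lt_le_trans vr _; lra.
have [N hN] := aF u ur' _ d2; have [M hM] := aF v vr' _ d2.
have {}hN := hN (maxn N M).+2 (leq_trans (leq_maxl _ _) (leq_trans (leqnSn _) (leqnSn _))).
have {}hM := hM (maxn N M).+2 (leq_trans (leq_maxr _ _) (leq_trans (leqnSn _) (leqnSn _))).
have := part (maxn N M); move: hN hM.
set S := \sum_(_ < _) _; set T := \sum_(_ < _) _ => hN hM hp.
rewrite [X in normc X](_ : _ = (F u - S) - (F v - T) + (S - T - a 1%N * (u - v))); last by ring.
apply: le_trans (le_normcD _ _) _; apply: lerD => //.
by apply: le_trans (le_normcD _ _) _; rewrite normcN; lra.
Qed.

Lemma powser0 a F r : 0 < r -> powser a F r -> F 0 = a 0%N.
Proof.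
move=> r0 aF; apply/eqP; rewrite -subr_eq0; apply/eqP/normc_eq0P/eqP.
rewrite eq_le normc_ge0 andbT; apply/ler_addgt0Pl => e e0; rewrite addr0.
have [|N hN] := aF 0 _ e e0; first by rewrite normc0.
have := hN N.+1 (leqnSn N); rewrite big_ord_recl /= expr0 mulr1 big1 ?addr0//.
by move=> i _; rewrite /bump /= add1n expr0n mulr0.
Qed.

(** Filling the hole with [a 1] makes the difference quotient a power series again, which gives its
    differentiability at the removed point. *)
Lemma powser_quot a F r : 0 < r -> powser a F r ->
  powser (fun n => a n.+1) (fun u => if u == 0 then a 1%N else (F u - F 0) / u) r.
Proof.
move=> r0 aF u ur e e0; have F0 := powser0 r0 aF.
have [->|u0] := eqVneq u 0.
  exists 1%N => -[//|n] _; rewrite big_ord_recl /= expr0 mulr1 big1 ?addr0.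
    by rewrite subrr normc0 ltW.
  by move=> i _; rewrite /bump /= add1n expr0n mulr0.
have nu : 0 < normc u.
  by rewrite lt_def normc_ge0 andbT; apply/eqP => /normc_eq0P/eqP; exact/negP.
have [|N hN] := aF u ur (e * normc u); first by rewrite mulr_gt0.
exists N => n Nn; have := hN n.+1 (leqW Nn).
rewrite big_ord_recl /= expr0 mulr1 -F0.
have -> : \sum_(i < n) a (bump 0 i) * u ^+ bump 0 i = u * \sum_(k < n) a k.+1 * u ^+ k.
  rewrite mulr_sumr; apply: eq_bigr => i _.
  by rewrite /bump /= add1n exprS; ring.
set S := \sum_(_ < _) _ => h.
rewrite -(ler_pM2r nu) -normcM; apply: le_trans h.
rewrite le_eqVlt; apply/orP; left; apply/eqP; congr (normc _); field; exact: u0.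
Qed.

Lemma sdiff_shift F z p q : sdiff (fun u => F (z + u)) 0 p q -> sdiff F z p q.
Proof.
move=> sF e /sF [d d0 dF]; exists d => // a b az bz.
have := dF (a - z) (b - z); rewrite !subr0 => /(_ az bz).
rewrite !(addrC z) !subrK.
by have -> : a - z - (b - z) = a - b by ring.
Qed.

Lemma powser_sdiff_at a f z r : 0 < r -> powser a (fun u => f (z + u)) r ->
  sdiff f z (a 1%N) ('i * a 1%N).
Proof. by move=> r0 /(powser_sdiff r0)/sdiff_shift. Qed.

End PowerSeries.

(** * Green's formula *)

Section Green.
Context {R : realType}.
Implicit Types (g : R * R -> R) (G P Q : R[i] -> R[i]).

Definition cont2 g := forall p (e : R), 0 < e -> exists2 d : R, 0 < d &
  forall q, `|q.1 - p.1| < d -> `|q.2 - p.2| < d -> `|g q - g p| <= e.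

(** A superlevel set is open, hence the union of the rational boxes it contains, and there are
    countably many of these. *)
Lemma cont2_measurable g : cont2 g ->
  measurable_fun [set: measurableTypeR R * measurableTypeR R]
    (g : measurableTypeR R * measurableTypeR R -> measurableTypeR R).
Proof.
move=> cg; apply: (measurability _ (RGenOInfty.measurableE R)).
move=> _ [_ [c ->] <-]; rewrite setTI.
pose box (t : rat * rat * rat) : set (measurableTypeR R * measurableTypeR R) :=
  `](ratr t.1.1 - ratr t.2), (ratr t.1.1 + ratr t.2)[%classic `*`
  `](ratr t.1.2 - ratr t.2), (ratr t.1.2 + ratr t.2)[%classic.
set A := (X in measurable X).
have -> : A = \bigcup_t (if `[< box t `<=` A >] then box t else set0).
  apply/seteqP; split=> [p Ap|p [t _]]; last first.
    by case: ifPn => // /asboolP h /h.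
  have gp : 0 < (g p - c) / 2.
    by move: Ap; rewrite /A /= in_itv /= andbT => ?; rewrite divr_gt0// subr_gt0.
  have [d d0 dg] := cg p _ gp.
  have [|rho] := @rat_in_itvoo R 0 (d / 2); first by rewrite divr_gt0.
  rewrite in_itv /= => /andP[r0 rd].
  have [|a] := @rat_in_itvoo R (p.1 - ratr rho) (p.1 + ratr rho); first by lra.
  rewrite in_itv /= => /andP[a1 a2].
  have [|b] := @rat_in_itvoo R (p.2 - ratr rho) (p.2 + ratr rho); first by lra.
  rewrite in_itv /= => /andP[b1 b2].
  exists (a, b, rho) => //; case: ifPn => [_|/asboolPn[]].
    by split; rewrite /= in_itv /=; apply/andP; split; lra.
  move=> q [] /=; rewrite !in_itv /= => /andP[q1 q2] /andP[q3 q4].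
  rewrite /A /= in_itv /= andbT.
  have := dg q; rewrite !ltr_norml => /(_ _ _)/ler_normlP[||h1 h2].
  - by apply/andP; split; lra.
  - by apply/andP; split; lra.
  - by lra.
apply: countable_bigcupT_measurable => // t; case: ifPn => // _.
by apply: measurableX; exact: measurable_itv.
Qed.

(** A box containing the disk: its sections are intervals, which suits Fubini's theorem and the
    fundamental theorem of calculus. *)
Definition square : set (measurableTypeR R * measurableTypeR R) :=
  `[-1, 1]%classic `*` `[-1, 1]%classic.

Lemma cont2_bounded g : cont2 g -> exists M, forall p, square p -> `|g p| <= M.
Proof.
move=> cg; have cg' : continuous g.
  move=> p; apply/cvgrPdist_le => e /(cg p)[d d0 dg].
  exists (ball p.1 d, ball p.2 d); first by split; exact: nbhsx_ballx.
  move=> q [/= h1 h2]; rewrite distrC.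
  by apply: dg; rewrite distrC.
have cK : compact (g @` (`[-1, 1]%classic `*` `[-1, 1]%classic)).
  apply: continuous_compact; first exact: continuous_subspaceT.
  by apply: compact_setX; exact: segment_compact.
have [M [_ hM]] := compact_bounded cK.
exists (M + 1) => p sp; apply: (hM (M + 1)); first by rewrite ltrDl.
by exists p.
Qed.

Let leb2 := (@lebesgue_measure R \x @lebesgue_measure R)%E.

Lemma measurable_square : measurable square.
Proof. by apply: measurableX; exact: measurable_itv. Qed.

Lemma leb2_square : (leb2 square < +oo)%E.
Proof.
rewrite /leb2 /square product_measure1E; [|exact: measurable_itv|exact: measurable_itv].
have L : lebesgue_measure (`[-1, 1]%classic : set R) = 2%:E.
  by rewrite lebesgue_measure_itv /= lte_fin ifT -?EFinB; [congr EFin|]; lra.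
rewrite -[X in (X * _)%E]/(lebesgue_measure (`[-1, 1]%classic : set R)).
rewrite -[X in (_ * X)%E]/(lebesgue_measure (`[-1, 1]%classic : set R)).
by rewrite L -EFinM ltry.
Qed.

Lemma cont2_integrable g : cont2 g -> (forall p, ~ square p -> g p = 0) ->
  leb2.-integrable setT (EFin \o g).
Proof.
move=> cg g0; have [M gM] := cont2_bounded cg.
have mg := cont2_measurable cg.
have gE : (EFin \o g) = (EFin \o g) \_ square.
  apply/funext => p; rewrite patchE; case: ifPn => //.
  by rewrite notin_setE => /g0 /= ->.
rewrite gE; apply/(integrable_mkcond _ measurable_square).
apply: measurable_bounded_integrable => //.
- exact: measurable_square.
- exact: leb2_square.
- exact: measurable_funTS.
- by exists M; split; [exact: num_real|move=> y My p /gM /le_trans; apply; exact: ltW].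
Qed.

Lemma integral_derive0 (v v' : R -> R) : (forall x : R, is_derive x (1 : R) v (v' x)) ->
  continuous v' -> v (-1) = 0 -> v 1 = 0 ->
  (forall x, ~ `[-1, 1]%classic x -> v' x = 0) ->
  (\int[@lebesgue_measure R]_x (v' x)%:E = 0)%E.
Proof.
move=> dv cv vm v1 v'0.
have cv1 : continuous v.
  by move=> x; apply/differentiable_continuous/derivable1_diffP; have [] := dv x.
have -> : (fun x => (v' x)%:E) = (EFin \o v') \_ `[-1, 1]%classic.
  apply/funext => x; rewrite patchE; case: ifPn => //.
  by rewrite notin_setE => /v'0 /= ->.
rewrite -integral_mkcond (@continuous_FTC2 _ v' v).
- by rewrite vm v1 -EFinB subrr.
- by lra.
- exact: continuous_subspaceT.
- split.
  + by move=> x _; have [] := dv x.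
  + exact/cvg_at_right_filter/cv1.
  + exact/cvg_at_left_filter/cv1.
- by move=> x _; rewrite derive1E; apply: derive_val.
Qed.

Lemma integral_dA0 g : cont2 g -> (forall p, ~ square p -> g p = 0) ->
  (forall p, ~ disk2 p -> g p = 0) -> (\int[leb2]_p (g p)%:E = 0)%E ->
  (@dA R).-integrable disk2 (EFin \o g) /\ \int[dA]_(p in disk2) g p = 0.
Proof.
move=> cg gs gd g0; have ig := cont2_integrable cg gs.
have mg := measurable_int _ ig.
have mD := @measurable_disk2 R.
have gE : (EFin \o g) = (EFin \o g) \_ disk2.
  apply/funext => p; rewrite patchE; case: ifPn => //.
  by rewrite notin_setE => /gd /= ->.
have scale f : measurable_fun setT f -> (forall p, 0 <= f p)%E ->
    (\int[dA]_(p in disk2) f p = (pi : R)^-1%:E * \int[leb2]_(p in disk2) f p)%E.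
  move=> mf f0; rewrite /dA ge0_integral_mscale//.
  exact: measurable_funTS.
have igd : leb2.-integrable disk2 (EFin \o g).
  by apply: integrableS ig => //.
split.
  apply/integrableP; split; first exact: measurable_funTS.
  rewrite scale//; last exact: measurableT_comp.
  rewrite lte_mul_pinfty ?lee_fin ?invr_ge0 ?pi_ge0//.
  by case/integrableP : igd.
(* The factor 1/pi is pulled out of integrals of nonnegative functions, so the positive and negative
   parts are scaled separately and recombined. *)
rewrite /Rintegral integralE !scale//.
- rewrite -muleBr.
  + by rewrite -integralE integral_mkcond -gE g0 mule0.
  + by [].
  + by apply: fin_num_adde_defr; rewrite integrable_pos_fin_num.
- exact: measurable_funeneg.
- exact: measurable_funepos.
Qed.

End Green.

Section GreenComplex.
Context {R : realType}.
Implicit Types (G P Q : R[i] -> R[i]) (rho : R).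

Lemma is_derive_quot (v : R -> R) (x d : R) :
  (forall e : R, 0 < e -> exists2 t : R, 0 < t & forall h, `|h| < t -> h != 0 ->
     `|v (x + h) - v x - d * h| <= e * `|h|) ->
  is_derive x (1 : R) v d.
Proof.
move=> hv; have cv : (fun h => h^-1 *: (v (h *: (1 : R) + x) - v x)) @ (0 : R)^' --> d.
  apply/cvgrPdist_le => e /hv[t t0 ht].
  apply/nbhs_ballP; exists t => // h; rewrite /ball /= sub0r normrN => h1 h0.
  rewrite -[h *: 1]/(h * 1) mulr1 (addrC h).
  have nh : 0 < `|h| by rewrite normr_gt0.
  rewrite -(ler_pM2r nh); apply: le_trans (ht h h1 h0); rewrite -normrM.
  rewrite le_eqVlt; apply/orP; left; apply/eqP; rewrite -normrN; congr (`|_|).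
  by rewrite -[_ *: _]/(_ * _); field.
by split; [apply/cvg_ex; exists d|exact/cvg_lim].
Qed.

Lemma normc_toC_le (p q : R * R) (d : R) :
  `|q.1 - p.1| < d / 2 -> `|q.2 - p.2| < d / 2 -> normc (toC q - toC p) < d.
Proof. by move=> h1 h2; apply: le_lt_trans (normc_leReIm _) _ => /=; lra. Qed.

Lemma square_normc (p : R * R) : ~ square p -> 1 <= normc (toC p).
Proof.
move=> np; rewrite leNgt; apply/negP => h; apply: np.
have h1 := le_lt_trans (absRe_le_normc (toC p)) h.
have h2 := le_lt_trans (absIm_le_normc (toC p)) h.
move: h1 h2; rewrite /= !ltr_norml => /andP[? ?] /andP[? ?].
by split; rewrite /= in_itv /=; apply/andP; split; lra.
Qed.

Lemma cont2_sdiff G P Q : (forall z, sdiff G z (P z) (Q z)) ->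
  cont2 (fun p => complex.Re (P (toC p))) /\ cont2 (fun p => complex.Re (Q (toC p))).
Proof.
move=> sG; split=> p e e0;
  have [d d0 dG] := sdiff_near_p ltr01 (fun w _ => sG w) e0 (z := toC p);
  (exists (d / 2); first by rewrite divr_gt0) => q q1 q2; rewrite -raddfB;
  apply: le_trans (absRe_le_normc _) _; have [] := dG (toC q) => //;
  exact: normc_toC_le.
Qed.

(** Where [G] vanishes locally it also has zero partial derivatives, and these are unique. *)
Lemma sdiff_out G P Q rho : (forall z, sdiff G z (P z) (Q z)) ->
  (forall z, rho <= normc z -> G z = 0) ->
  forall z, rho < normc z -> P z = 0 /\ Q z = 0.
Proof.
move=> sG G0 z rz; apply: sdiff_uniq (sG z) _.
apply: (@sdiff_eq _ (fun=> 0) _ _ _ _ (normc z - rho)).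
- by rewrite subr_gt0.
- move=> w wz; rewrite G0//.
  have := normc_subD z w; rewrite normc_sym; lra.
- exact: sdiff_cst.
Qed.

(** The x-derivative integrates to 0 along every horizontal line and the y-derivative along every
    vertical one, since [G] vanishes at both ends. The two halves therefore use opposite orders of
    integration. *)
Lemma green_Re G P Q rho : rho < 1 -> (forall z, sdiff G z (P z) (Q z)) ->
  (forall z, rho <= normc z -> G z = 0) ->
  ((@dA R).-integrable disk2 (fun p => (complex.Re (P (toC p)))%:E) /\
   \int[dA]_(p in disk2) complex.Re (P (toC p)) = 0) /\
  ((@dA R).-integrable disk2 (fun p => (complex.Re (Q (toC p)))%:E) /\
   \int[dA]_(p in disk2) complex.Re (Q (toC p)) = 0).
Proof.
move=> r1 sG G0; have [cP cQ] := cont2_sdiff sG.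
have out z : 1 <= normc z -> P z = 0 /\ Q z = 0.
  by move=> z1; apply: (sdiff_out sG G0); exact: lt_le_trans z1.
have Gout z : 1 <= normc z -> G z = 0.
  by move=> z1; apply: G0; apply: le_trans z1; exact: ltW.
have nd p : ~ disk2 p -> 1 <= normc (@toC R p).
  by move=> np; rewrite leNgt; apply/negP => h; apply: np; exact/diskE.
have sq1 (x y : R) : ~ `[-1, 1]%classic x -> ~ square (x, y) by move=> h [].
have sq2 (x y : R) : ~ `[-1, 1]%classic y -> ~ square (x, y) by move=> h [].
have b1 (x y : R) : `|x| = 1 -> 1 <= normc (x +i* y).
  by move=> <-; exact: (absRe_le_normc (x +i* y)).
have b2 (x y : R) : `|y| = 1 -> 1 <= normc (x +i* y).
  by move=> <-; exact: (absIm_le_normc (x +i* y)).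
split; apply: integral_dA0 => //.
- by move=> p /square_normc/out[-> _].
- by move=> p /nd/out[-> _].
- rewrite -integral21_prod_meas1; last first.
    by apply: cont2_integrable => // p /square_normc/out[-> _].
  rewrite integral0_eq// => y _.
  apply: (@integral_derive0 _ (fun x => complex.Re (G (x +i* y)))).
  + move=> x; apply: is_derive_quot => e e0.
    have [d d0 dG] := sG (x +i* y) e e0.
    exists d => // h hd _; have := dG ((x + h) +i* y) (x +i* y).
    rewrite subrr normc0.
    have -> : (x + h) +i* y - (x +i* y) = h%:C.
      by apply/eqP; rewrite eq_complex /= subrr addrC addKr !eqxx.
    rewrite normc_real => /(_ hd d0); apply: le_trans.
    apply: le_trans (absRe_le_normc _); rewrite !raddfB/= /lin /=.
    by rewrite le_eqVlt; apply/orP; left; apply/eqP; congr (`|_|);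
      case: (P _) => a b /=; case: (Q _) => a' b' /=; ring.
  + move=> x; apply/cvgrPdist_le => e e0; have [d d0 dc] := cP (x, y) e e0.
    apply/nbhs_ballP; exists d => // x' /= xx; rewrite distrC.
    by apply: (dc (x', y)) => /=; rewrite ?subrr ?normr0// distrC.
  + by rewrite Gout// b1// normrN1.
  + by rewrite Gout// b1// normr1.
  + by move=> x /(sq1 x y)/square_normc/out[-> _].
- by move=> p /square_normc/out[_ ->].
- by move=> p /nd/out[_ ->].
- rewrite -integral12_prod_meas1; last first.
    by apply: cont2_integrable => // p /square_normc/out[_ ->].
  rewrite integral0_eq// => x _.
  apply: (@integral_derive0 _ (fun y => complex.Re (G (x +i* y)))).
  + move=> y; apply: is_derive_quot => e e0.
    have [d d0 dG] := sG (x +i* y) e e0.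
    exists d => // h hd _; have := dG (x +i* (y + h)) (x +i* y).
    rewrite subrr normc0.
    have -> : x +i* (y + h) - (x +i* y) = 0 +i* h.
      by apply/eqP; rewrite eq_complex /= subrr addrC addKr !eqxx.
    have -> : normc (0 +i* h) = `|h| by rewrite /= expr0n add0r sqrtr_sqr.
    move=> /(_ hd d0); apply: le_trans.
    apply: le_trans (absRe_le_normc _); rewrite !raddfB/= /lin /=.
    by rewrite le_eqVlt; apply/orP; left; apply/eqP; congr (`|_|);
      case: (P _) => a b /=; case: (Q _) => a' b' /=; ring.
  + move=> y; apply/cvgrPdist_le => e e0; have [d d0 dc] := cQ (x, y) e e0.
    apply/nbhs_ballP; exists d => // y' /= yy; rewrite distrC.
    by apply: (dc (x, y')) => /=; rewrite ?subrr ?normr0// distrC.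
  + by rewrite Gout// b2// normrN1.
  + by rewrite Gout// b2// normr1.
  + by move=> y /(sq2 x y)/square_normc/out[_ ->].
Qed.

Lemma Re_mulNi (z : R[i]) : complex.Re (- 'i * z) = complex.Im z.
Proof. by case: z => a b /=; ring. Qed.

Lemma sdiff_scale (c : R[i]) G z p q : sdiff G z p q ->
  sdiff (fun w => c * G w) z (c * p) (c * q).
Proof.
move=> sG; have := sdiffM (sdiff_cst c z) sG.
by rewrite !mul0r !add0r.
Qed.

(** The imaginary parts are the real parts for the function [- 'i * G]. *)
Lemma green G P Q rho : rho < 1 -> (forall z, sdiff G z (P z) (Q z)) ->
  (forall z, rho <= normc z -> G z = 0) ->
  [/\ cintegrable P, cintegrable Q, cintegral P = 0 & cintegral Q = 0].
Proof.
move=> r1 sG G0; have [[p1 p2] [q1 q2]] := green_Re r1 sG G0.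
have [|[p3 p4] [q3 q4]] := green_Re r1 (fun z => sdiff_scale (- 'i) (sG z)).
  by move=> z /G0 ->; rewrite mulr0.
have E (F : R[i] -> R[i]) : (fun p => (complex.Re (- 'i * F (@toC R p)))%:E) =
    (fun p => (complex.Im (F (toC p)))%:E) by apply/funext => p; rewrite Re_mulNi.
have E' (F : R[i] -> R[i]) : \int[dA]_(p in disk2) complex.Re (- 'i * F (@toC R p)) =
   \int[dA]_(p in disk2) complex.Im (F (toC p)) :> R.
  by apply: eq_Rintegral => p _; rewrite Re_mulNi.
move: p3 p4 q3 q4; rewrite !E !E' => p3 p4 q3 q4.
by split=> //; rewrite /cintegral ?p2 ?p4 ?q2 ?q4.
Qed.

Lemma cmeas_sdiff G P Q : (forall z, sdiff G z (P z) (Q z)) -> cmeas G.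
Proof.
move=> sG; have H F (P' Q' : R[i] -> R[i]) : (forall z, sdiff F z (P' z) (Q' z)) ->
    measurable_fun disk2 (fun p => complex.Re (F (@toC R p))).
  move=> sF; apply: measurable_funTS.
  apply: cont2_measurable => p e e0.
  have [d d0 dG] := sdiff_cont (sF (toC p)) e0.
  exists (d / 2); first by rewrite divr_gt0.
  move=> q q1 q2; rewrite -raddfB; apply: le_trans (absRe_le_normc _) _.
  have qp : normc (toC q - toC p) < d by exact: normc_toC_le.
  by have [] := dG _ _ qp qp.
split; first exact: H sG.
have := H _ _ _ (fun z => sdiff_scale (- 'i) (sG z)).
by under eq_fun do rewrite Re_mulNi.
Qed.

End GreenComplex.

(** * Power series expansion with bounded coefficients *)

Section Bump.
Context {R : realType}.
Implicit Types (n m : R[i] -> R) (z w : R[i]) (p q x a b c e : R).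

Definition rsdiff n z p q := sdiff (fun w => (n w)%:C) z p%:C q%:C.

Lemma rsdiff_eq n z p q p' q' : rsdiff n z p q -> p = p' -> q = q' ->
  rsdiff n z p' q'.
Proof. by move=> ? <- <-. Qed.

Lemma rsdiff_cst c z : rsdiff (fun=> c) z 0 0.
Proof. exact: sdiff_cst. Qed.

Lemma rsdiffD n m z p q p' q' : rsdiff n z p q -> rsdiff m z p' q' ->
  rsdiff (fun w => n w + m w) z (p + p') (q + q').
Proof.
move=> sn sm; rewrite /rsdiff !rmorphD /=.
by under eq_fun do rewrite rmorphD /=; exact: sdiffD.
Qed.

Lemma rsdiffM n m z p q p' q' : rsdiff n z p q -> rsdiff m z p' q' ->
  rsdiff (fun w => n w * m w) z (p * m z + n z * p') (q * m z + n z * q').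
Proof.
move=> sn sm; rewrite /rsdiff !rmorphD /= !rmorphM /=.
by under eq_fun do rewrite rmorphM /=; exact: sdiffM.
Qed.

Definition pos x : R := Num.max 0 x.

Lemma pos_ge0 x : 0 <= pos x. Proof. by rewrite le_max lexx. Qed.

Lemma pos_le0 x : x <= 0 -> pos x = 0.
Proof. by move=> x0; rewrite /pos maxEle; case: ifP => // ?; lra. Qed.

Lemma pos_gt0 x : 0 <= x -> pos x = x.
Proof. by move=> x0; rewrite /pos maxEle x0. Qed.

Lemma mul_pos x : x * pos x = pos x ^+ 2.
Proof.
have [x0|x0] := leP x 0; first by rewrite pos_le0// mulr0 expr0n.
by rewrite pos_gt0 ?expr2// ltW.
Qed.

(** Here [a] and [b] are the moving points and [c] is the base point. The square of the positive
    part deviates from its tangent at [b] by at most the square of [a - b]; moving the slope from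
    [b] to [c] costs [2 * |b - c|], as [pos] is 1-Lipschitz. *)
Lemma pos2_taylor a b c : `|pos a ^+ 2 - pos b ^+ 2 - 2 * pos c * (a - b)| <=
  (`|a - b| + 2 * `|b - c|) * `|a - b|.
Proof.
have h1 : `|pos a ^+ 2 - pos b ^+ 2 - 2 * pos b * (a - b)| <= `|a - b| * `|a - b|.
  rewrite -expr2 real_normK ?num_real//.
  have [a0|a0] := leP a 0.
    rewrite (pos_le0 a0); have [b0|b0] := leP b 0.
      by rewrite (pos_le0 b0) !(mulr0, mul0r) expr0n subrr subr0 normr0 sqr_ge0.
    have ab : 0 <= b * - a by rewrite mulr_ge0 ?oppr_ge0// ltW.
    have := sqr_ge0 a; have := sqr_ge0 b; rewrite (pos_gt0 (ltW b0)) expr0n /=.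
    by move=> a2 b2; rewrite ler_norml; apply/andP; split; lra.
  rewrite (pos_gt0 (ltW a0)); have [b0|b0] := leP b 0.
    rewrite (pos_le0 b0) !(mulr0, mul0r) expr0n !subr0 ger0_norm ?sqr_ge0//.
    by rewrite lerXn2r ?nnegrE; lra.
  rewrite (pos_gt0 (ltW b0)) (_ : _ - _ = (a - b) ^+ 2); last by ring.
  by rewrite ger0_norm ?sqr_ge0.
have h2 : `|pos b - pos c| <= `|b - c|.
  have [b0|b0] := leP b 0.
    rewrite (pos_le0 b0); have [c0|c0] := leP c 0.
      by rewrite (pos_le0 c0) subrr normr0.
    by rewrite (pos_gt0 (ltW c0)) sub0r normrN gtr0_norm// ler0_norm; lra.
  rewrite (pos_gt0 (ltW b0)); have [c0|c0] := leP c 0.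
    by rewrite (pos_le0 c0) subr0 gtr0_norm// ger0_norm; lra.
  by rewrite (pos_gt0 (ltW c0)).
rewrite (_ : pos a ^+ 2 - _ - _ = (pos a ^+ 2 - pos b ^+ 2 - 2 * pos b * (a - b)) +
  2 * (pos b - pos c) * (a - b)); last by ring.
apply: le_trans (ler_normD _ _) _; rewrite [leRHS]mulrDl; apply: lerD => //.
by rewrite !normrM ler_wpM2r// ger0_norm// ler_wpM2l.
Qed.

Lemma rsdiff_pos2 n z p q : rsdiff n z p q ->
  rsdiff (fun w => pos (n w) ^+ 2) z (2 * pos (n z) * p) (2 * pos (n z) * q).
Proof.
move=> sn e e0.
set K := 1 + normc p%:C + normc q%:C.
have K0 : 0 < K by rewrite /K -addrA ltr_pwDl// addr_ge0// normc_ge0.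
(* The Taylor error is at most [4 * k * K * N], which is half of [e * N]; the other half is left for
   the linearization error of [n], controlled by [j]. *)
pose k := e / (8 * K); have k0 : 0 < k by rewrite divr_gt0// mulr_gt0.
have c0 := pos_ge0 (n z).
pose j := e / (2 * (1 + 2 * pos (n z))).
have j0 : 0 < j by rewrite divr_gt0// mulr_gt0//; lra.
apply: near2_sub (near2_and (sn _ j0) (near2_and (sdiff_cont sn k0) (sdiff_lip sn))).
move=> u v [hl [[ha hb] hK]].
move: ha hb hK; rewrite -!rmorphB !normc_real -/K => ha hb hK.
set N := normc (u - v) in hl hK *.
have N0 : 0 <= N by exact: normc_ge0.
have linE x : lin (2 * x * p)%:C (2 * x * q)%:C (u - v) = (2 * x)%:C * lin p%:C q%:C (u - v).
  by rewrite -linZ -!rmorphM.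
rewrite linE.
have := pos2_taylor (n u) (n v) (n z) => ht.
rewrite [X in normc X](_ : _ = (pos (n u) ^+ 2 - pos (n v) ^+ 2 -
    2 * pos (n z) * (n u - n v))%:C + (2 * pos (n z))%:C *
    ((n u)%:C - (n v)%:C - lin p%:C q%:C (u - v))); last first.
  by rewrite !(rmorphB, rmorphM) /=; ring.
apply: le_trans (le_normcD _ _) _; rewrite normcM !normc_real.
have uv : `|n u - n v| <= 2 * k.
  by apply: le_trans (ler_distD (n z) _ _) _; rewrite (distrC (n z)); lra.
rewrite [leRHS](_ : _ = e / 2 * N + e / 2 * N); last by rewrite -mulrDl -splitr.
apply: lerD.
  apply: le_trans ht _; apply: (@le_trans _ _ (4 * k * (K * N))).
    have := normr_ge0 (n u - n v); have := normr_ge0 (n v - n z) => ? ?.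
    by apply: ler_pM => //; [lra|rewrite /K !normc_real].
  rewrite le_eqVlt; apply/orP; left; apply/eqP; rewrite /k; field.
  by rewrite gt_eqF.
rewrite ger0_norm ?mulr_ge0//; apply: (@le_trans _ _ (2 * pos (n z) * (j * N))).
  by apply: ler_wpM2l => //; rewrite mulr_ge0.
rewrite mulrA ler_wpM2r// /j mulrA ler_pdivrMr ?mulr_gt0//; last by lra.
nra.
Qed.

(** The cube of the positive part, in a form suited to the product rule. The cube is chosen because
    its derivative [3 * pos x ^+ 2] is again strictly differentiable. *)
Definition pos3 x := x * pos x ^+ 2.

Lemma rsdiff_pos3 n z p q : rsdiff n z p q ->
  rsdiff (fun w => pos3 (n w)) z (3 * pos (n z) ^+ 2 * p) (3 * pos (n z) ^+ 2 * q).
Proof.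
move=> sn; have := rsdiffM sn (rsdiff_pos2 sn).
have E r : r * pos (n z) ^+ 2 + n z * (2 * pos (n z) * r) = 3 * pos (n z) ^+ 2 * r.
  rewrite (_ : n z * _ = 2 * (n z * pos (n z)) * r); last by ring.
  by rewrite mul_pos; ring.
by rewrite !E.
Qed.

Context (z0 : R[i]) (r1 K : R).
Local Notation u w := (w - z0).

(* [eta] is a cutoff equal to 1 for [|u|^2 <= r1] and, for the [K] used below, to 0
   for [|u|^2 >= r2]. Its gradient is [- 18 K omega u], where [omega] is itself of
   class C^1, with gradient [domega u]. *)
Definition bumpA w := normc (u w) ^+ 2 - r1.
Definition bumpB w := 1 - K * pos3 (bumpA w).
Definition eta w := pos3 (bumpB w).
Definition omega w := pos (bumpA w) ^+ 2 * pos (bumpB w) ^+ 2.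
Definition domega w := 4 * pos (bumpA w) * pos (bumpB w) ^+ 2 -
  12 * K * pos (bumpA w) ^+ 4 * pos (bumpB w).

Lemma rsdiff_bumpA w : rsdiff bumpA w (2 * complex.Re (u w)) (2 * complex.Im (u w)).
Proof.
have s1 : sdiff (fun w => u w) w 1 'i.
  by have := sdiffD (sdiff_id w) (sdiff_cst (- z0) w); rewrite !addr0.
have s2 : sdiff (fun w => (u w)^*%C) w 1 (- 'i).
  have := sdiffD (sdiff_conj w) (sdiff_cst (- z0)^*%C w); rewrite !addr0.
  by under eq_fun do rewrite -rmorphD /=.
have := sdiffD (sdiffM s1 s2) (sdiff_cst (- r1)%:C w); rewrite !addr0 /rsdiff.
have -> : (fun w0 => u w0 * (u w0)^*%C + (- r1)%:C) = (fun w0 => (bumpA w0)%:C).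
  by apply/funext => x; rewrite mulcJ -rmorphD.
congr (sdiff _ _ _ _); case: (u w) => a b; apply/eqP; rewrite eq_complex /=;
  apply/andP; split; apply/eqP; ring.
Qed.

Lemma rsdiff_bumpB w :
  rsdiff bumpB w (- 6 * K * pos (bumpA w) ^+ 2 * complex.Re (u w))
                 (- 6 * K * pos (bumpA w) ^+ 2 * complex.Im (u w)).
Proof.
have := rsdiffD (rsdiff_cst 1 w) (rsdiffM (rsdiff_cst (- K) w)
  (rsdiff_pos3 (rsdiff_bumpA w))).
have -> : (fun w0 => 1 + - K * pos3 (bumpA w0)) = bumpB.
  by apply/funext => x; rewrite /bumpB mulNr.
by move/rsdiff_eq; apply; ring.
Qed.

Lemma rsdiff_eta w :
  rsdiff eta w (- 18 * K * omega w * complex.Re (u w))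
               (- 18 * K * omega w * complex.Im (u w)).
Proof.
by apply: (rsdiff_eq (rsdiff_pos3 (rsdiff_bumpB w))); rewrite /omega; ring.
Qed.

Lemma rsdiff_omega w :
  rsdiff omega w (domega w * complex.Re (u w)) (domega w * complex.Im (u w)).
Proof.
apply: (rsdiff_eq (rsdiffM (rsdiff_pos2 (rsdiff_bumpA w))
  (rsdiff_pos2 (rsdiff_bumpB w)))); rewrite /domega.
  by ring.
by ring.
Qed.

Lemma omega_ge0 w : 0 <= omega w.
Proof. by rewrite mulr_ge0// sqr_ge0. Qed.

Lemma bump_inner w : normc (u w) ^+ 2 <= r1 -> omega w = 0 /\ domega w = 0.
Proof.
move=> h; rewrite /omega /domega (@pos_le0 (bumpA w)) ?subr_le0//.
by rewrite !expr0n /= !(mulr0, mul0r) subr0.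
Qed.

(** This value of [K] is the one for which [bumpB] decreases to 0 exactly at squared radius [r2]. *)
Lemma bump_outer w r2 : 0 <= r1 < r2 -> K = (r2 - r1) ^- 3 -> r2 <= normc (u w) ^+ 2 ->
  eta w = 0 /\ omega w = 0.
Proof.
move=> /andP[r10 r12] KE h; have d0 : 0 < r2 - r1 by rewrite subr_gt0.
have Aw : r2 - r1 <= bumpA w by rewrite lerB.
have A0 : 0 <= bumpA w by apply: le_trans Aw; exact: ltW.
have B0 : bumpB w <= 0.
  rewrite /bumpB /pos3 pos_gt0// subr_le0 KE mulrC ler_pdivlMr ?exprn_gt0// mul1r.
  by rewrite -exprS lerXn2r ?nnegrE// ltW.
by rewrite /eta /omega /pos3 (pos_le0 B0) expr0n /= !mulr0.
Qed.

Lemma omega_pos w r2 : r1 < r2 -> K = (r2 - r1) ^- 3 ->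
  r1 < normc (u w) ^+ 2 < r2 -> 0 < omega w.
Proof.
move=> r12 KE /andP[h1 h2]; have d0 : 0 < r2 - r1 by rewrite subr_gt0.
have A0 : 0 < bumpA w by rewrite subr_gt0.
have B0 : 0 < bumpB w.
  rewrite /bumpB /pos3 pos_gt0; last exact: ltW.
  rewrite subr_gt0 KE mulrC ltr_pdivrMr ?exprn_gt0// mul1r -exprS.
  by rewrite ltrXn2r ?nnegrE ?ltW// ltrD2r.
by rewrite /omega !pos_gt0 ?ltW// mulr_gt0// exprn_gt0.
Qed.

Lemma omega_le w r2 : 0 <= r1 < r2 -> K = (r2 - r1) ^- 3 ->
  omega w <= (r2 - r1) ^+ 2.
Proof.
move=> r12 KE; have /andP[r10 r12'] := r12.
have [h|h] := leP r2 (normc (u w) ^+ 2).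
  by have [_ ->] := bump_outer r12 KE h; exact: sqr_ge0.
have K0 : 0 <= K by rewrite KE invr_ge0 exprn_ge0// subr_ge0 ltW.
have A1 : pos (bumpA w) <= r2 - r1.
  by rewrite /pos ge_max subr_ge0 ltW//= lerB// ltW.
have B1 : pos (bumpB w) <= 1.
  rewrite /pos ge_max ler01 /= gerBl mulr_ge0//.
  have [a0|a0] := leP (bumpA w) 0; first by rewrite /pos3 pos_le0// expr0n mulr0.
  by rewrite mulr_ge0 ?sqr_ge0// ltW.
rewrite -[leRHS]mulr1; apply: ler_pM; rewrite ?sqr_ge0//.
  by rewrite lerXn2r ?nnegrE ?pos_ge0// subr_ge0 ltW.
by rewrite exprn_ile1// pos_ge0.
Qed.

End Bump.

(** * Finiteness and positivity of the area measure *)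

Section DiskMass.
Context {R : realType}.

Lemma L2_cst (c : R[i]) : L2 (fun=> c).
Proof.
have [m1 m2] := cmeas_cst c; split=> //.
have D := @measurable_disk2 R.
rewrite integral_cst// lte_mul_pinfty ?lee_fin ?sqr_ge0//.
have -> : dA disk2 = ((pi : R)^-1%:E *
    (@lebesgue_measure R \x @lebesgue_measure R) (disk2 : set (R * R)))%E by [].
rewrite lte_mul_pinfty ?lee_fin ?invr_ge0 ?pi_ge0//.
apply: le_lt_trans (@leb2_square R); apply: le_measure; rewrite ?inE//.
  exact: measurable_square.
move=> p /diskE h; apply: contrapT => /square_normc; rewrite leNgt => /negP; exact.
Qed.

Lemma integral_disk_gt0 (g : R[i] -> R) (w : R[i]) (d e : R) :
  measurable_fun disk2 (fun p => g (toC p)) -> (forall z, disk z -> 0 <= g z) ->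
  disk w -> 0 < d -> 0 < e -> (forall z, normc (z - w) < d -> e <= g z) ->
  (0 < \int[dA]_(p in disk2) (g (toC p))%:E)%E.
Proof.
move=> mg g0 /diskE Dw d0 e0 ge.
(* Half the side of a box around [w]. A modulus is at most the sum of the absolute values of the
   real and imaginary parts, so the box lies in the ball of radius [2 * t]. *)
pose t := Num.min d (1 - normc w) / 2.
have m0 : 0 < Num.min d (1 - normc w) by rewrite lt_min d0 subr_gt0.
have t0 : 0 < t by rewrite divr_gt0.
pose x := complex.Re w; pose y := complex.Im w.
pose I (a : R) : set R := `]a - t, a + t[%classic.
pose box : set (measurableTypeR R * measurableTypeR R) := I x `*` I y.
have tE : t = Num.min d (1 - normc w) / 2 by [].
have boxw p : box p -> normc (toC p - w) < Num.min d (1 - normc w).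
  case=> /=; rewrite /I /= !in_itv /= => /andP[p1 p2] /andP[p3 p4].
  apply: le_lt_trans (normc_leReIm _) _; rewrite !raddfB /= -/x -/y.
  have q1 : `|p.1 - x| < t by rewrite ltr_norml; apply/andP; split; lra.
  have q2 : `|p.2 - y| < t by rewrite ltr_norml; apply/andP; split; lra.
  by move: (ltrD q1 q2); rewrite tE -splitr.
have mbox : measurable box by apply: measurableX; exact: measurable_itv.
have bD : box `<=` disk2.
  move=> p /boxw; rewrite lt_min => /andP[_ h]; apply/diskE.
  by have := normc_subD (toC p) w; lra.
have D := @measurable_disk2 R.
apply: (@lt_le_trans _ _ (\int[dA]_(p in box) (e%:E))%E); last first.
  apply: (@le_trans _ _ (\int[dA]_(p in box) (g (toC p))%:E)%E).
    apply: ge0_le_integral => //=.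
    - by move=> p _; rewrite lee_fin ltW.
    - by apply/measurable_EFinP; exact: measurable_funS mg.
    - by move=> p /boxw; rewrite lt_min => /andP[h _]; rewrite lee_fin ge.
  apply: ge0_subset_integral => //=.
  - exact/measurable_EFinP.
  - by move=> p Dp; rewrite lee_fin; apply: g0.
rewrite integral_cst// mule_gt0 ?lte_fin//.
have -> : dA box = ((pi : R)^-1%:E *
    (@lebesgue_measure R \x @lebesgue_measure R) (box : set (R * R)))%E by [].
rewrite mule_gt0 ?lte_fin ?invr_gt0 ?pi_gt0//.
have Ipos a : (0 < lebesgue_measure (I a))%E.
  rewrite /I lebesgue_measure_itv /= lte_fin ifT; last by lra.
  by rewrite -EFinB lte_fin; lra.
have -> : ((@lebesgue_measure R \x @lebesgue_measure R) (box : set (R * R)) =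
   lebesgue_measure (I x) * lebesgue_measure (I y))%E.
  by rewrite product_measure1E//; exact: measurable_itv.
exact: mule_gt0.
Qed.

(** Passes from norm zero to a pointwise zero: if [f w] were nonzero, continuity would keep the
    modulus of [f] above half its value at [w] on a set of positive area. *)
Lemma nrm2_eq0 (f : R[i] -> R[i]) (w : R[i]) : L2 f -> nrm2 f = 0 -> disk w ->
  (forall e : R, 0 < e -> exists2 d : R, 0 < d &
     forall z, normc (z - w) < d -> normc (f z - f w) <= e) -> f w = 0.
Proof.
move=> Lf f0 Dw fc; apply/normc_eq0P/eqP; rewrite eq_le normc_ge0 andbT leNgt.
apply/negP => n0; have n2 : 0 < normc (f w) / 2 by rewrite divr_gt0.
have [d d0 dP] := fc _ n2.
have e0 : 0 < (normc (f w) / 2) ^+ 2 by rewrite exprn_gt0.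
have := @integral_disk_gt0 (fun z => normc (f z) ^+ 2) w d _ _ _ Dw d0 e0.
rewrite -nrm2_EFin// f0 lte_fin ltxx => h; suff : false by []; apply: h.
- by apply: measurable_funX; exact: measurable_normc (L2_cmeas Lf).
- by move=> z _; exact: sqr_ge0.
- move=> z /dP h; rewrite lerXn2r ?nnegrE ?normc_ge0 ?(ltW n2)//.
  have := normc_subD (f w) (f z); rewrite normc_sym; lra.
Qed.

End DiskMass.

(** * Complex differentiability *)

Section Holomorphic.
Context {R : realType}.
Implicit Types (F G f : R[i] -> R[i]) (z w d : R[i]).

(** Strict differentiability together with the Cauchy-Riemann equation: the differential is
    multiplication by [d]. *)
Definition hol F z d := sdiff F z d ('i * d).

Lemma hol_cst c z : hol (fun=> c) z 0.
Proof. by rewrite /hol mulr0; exact: sdiff_cst. Qed.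

Lemma hol_id z : hol id z 1.
Proof. by rewrite /hol mulr1; exact: sdiff_id. Qed.

Lemma holD F G z d d' : hol F z d -> hol G z d' -> hol (fun w => F w + G w) z (d + d').
Proof. by move=> hF hG; rewrite /hol mulrDr; exact: sdiffD. Qed.

Lemma holM F G z d d' : hol F z d -> hol G z d' ->
  hol (fun w => F w * G w) z (d * G z + F z * d').
Proof.
move=> hF hG; have := sdiffM hF hG; rewrite /hol.
by congr (sdiff _ _ _ _); ring.
Qed.

Lemma holV F z d : hol F z d -> F z != 0 ->
  hol (fun w => (F w)^-1) z (- (F z) ^- 2 * d).
Proof.
move=> hF F0; have := sdiffV hF F0; rewrite /hol.
by congr (sdiff _ _ _ _); ring.
Qed.

Lemma hol_sub c z : hol (fun w => w - c) z 1.
Proof. by have := holD (hol_id z) (hol_cst (- c) z); rewrite addr0. Qed.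

Lemma hol_invX c z n : z - c != 0 ->
  hol (fun w => (w - c) ^- n) z (- n%:R * (z - c) ^- n.+1).
Proof.
move=> zc; elim: n => [|n ih].
  rewrite oppr0 mul0r; have := hol_cst 1 z.
  by congr (hol _ _ _); apply/funext => w; rewrite expr0 invr1.
have := holM ih (holV (hol_sub c z) zc).
have -> : (fun w => (w - c) ^- n * (w - c)^-1) = fun w => (w - c) ^- n.+1.
  by apply/funext => w; rewrite exprSr invfM.
congr (hol _ _ _); rewrite mulr1 -(natr1 n) !exprS; field.
by rewrite expf_neq0.
Qed.

Lemma analytic_hol f z : analytic f -> disk z -> exists d, hol f z d.
Proof.
move=> /analytic_powser af /af[a [r [r0 h]]]; exists (a 1%N).
exact: powser_sdiff_at h.
Qed.

Lemma hol_ext F G z d (t : R) : 0 < t ->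
  (forall w, normc (w - z) < t -> F w = G w) -> hol F z d -> hol G z d.
Proof. exact: sdiff_eq. Qed.

Lemma normc_gt0 z : z != 0 -> 0 < normc z.
Proof. by move=> z0; rewrite lt_def normc_ge0 andbT; apply/eqP => /normc_eq0P/eqP; exact/negP. Qed.

Lemma hol_quot f z : analytic f -> disk z -> exists a : R[i],
  forall w, disk w -> exists d,
    hol (fun w => if w == z then a else (f w - f z) / (w - z)) w d.
Proof.
move=> af Dz; have /analytic_powser/(_ _ Dz)[a [r [r0 h]]] := af.
exists (a 1%N) => w Dw; have [->|wz] := eqVneq w z.
  (* The series of the quotient at [z] starts with [a 1], [a 2], so its derivative there is
     [a 2]. *)
  exists (a 2%N); apply: sdiff_shift.
  have := powser_sdiff r0 (powser_quot r0 h).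
  congr (sdiff _ _ _ _); apply/funext => u.
  have uE : z + u - z = u by rewrite addrC addKr.
  by rewrite addr0 uE -(subr_eq0 (z + u)) uE.
have [d hd] := analytic_hol af Dw.
have wz' : w - z != 0 by rewrite subr_eq0.
exists (d * (w - z)^-1 + (f w - f z) * (- (w - z) ^- 2 * 1)).
have hq : hol (fun w => (f w - f z) / (w - z)) w
    (d * (w - z)^-1 + (f w - f z) * (- (w - z) ^- 2 * 1)).
  apply: holM (holV (hol_sub z w) wz').
  by have := holD hd (hol_cst (- f z) w); rewrite addr0.
apply: hol_ext (normc_gt0 wz') _ hq => x xw.
by case: eqVneq => // xz; move: xw; rewrite xz normc_sym ltxx.
Qed.

End Holomorphic.

(** * The annular kernel and its moments *)

Section BumpKernel.
Context {R : realType} (z0 : R[i]) (s : R).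
Context (s0 : 0 < s) (z0s : normc z0 + 2 * s < 1).
Implicit Types (F h : R[i] -> R[i]) (z w : R[i]).

(** The kernel lives on the annulus between radii [s] and [2 * s] around [z0]: the hole leaves room
    for negative powers, and [z0s] keeps the outer circle inside the unit disk. *)
Let r1 := s ^+ 2.
Let r2 := (2 * s) ^+ 2.
Let K := (r2 - r1) ^- 3.
Let M := (r2 - r1) ^+ 2.
Local Notation u w := (w - z0).
Local Notation om := (omega z0 r1 K).
Local Notation dom := (domega z0 r1 K).
Local Notation et := (eta z0 r1 K).

Let r12 : 0 <= r1 < r2.
Proof. by rewrite /r1 /r2 sqr_ge0 /= exprMn; have := exprn_gt0 2 s0; lra. Qed.

Lemma om_in w : normc (u w) <= s -> om w = 0 /\ dom w = 0.
Proof.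
by move=> h; apply: bump_inner; rewrite lerXn2r ?nnegrE ?normc_ge0// ltW.
Qed.

Lemma om_out w : 2 * s <= normc (u w) -> et w = 0 /\ om w = 0.
Proof.
move=> h; apply: bump_outer r12 erefl _.
by rewrite lerXn2r ?nnegrE ?normc_ge0// mulr_ge0// ltW.
Qed.

Lemma om_disk w : normc z0 + 2 * s <= normc w -> et w = 0 /\ om w = 0.
Proof. by move=> h; apply: om_out; have := normc_subD w z0; lra. Qed.

(** Inside the hole the product is locally 0, so [F] may be singular there. This serves both for
    negative powers of [w - z0] and for [1 / (w - z)]. *)
Lemma om_mul_sdiff F F' : (forall w, s <= normc (u w) -> hol F w (F' w)) ->
  forall w, sdiff (fun w => (om w)%:C * F w) w
    ((dom w * complex.Re (u w))%:C * F w + (om w)%:C * F' w)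
    ((dom w * complex.Im (u w))%:C * F w + (om w)%:C * ('i * F' w)).
Proof.
move=> hF w; have [sw|ws] := leP s (normc (u w)).
  by apply: sdiffM (hF _ sw); exact: rsdiff_omega.
have [-> ->] := om_in (ltW ws); rewrite !mul0r addr0.
apply: (@sdiff_eq _ (fun=> 0) _ _ _ _ (s - normc (u w))).
- by rewrite subr_gt0.
- move=> x xw; have [|-> _] := @om_in x; last by rewrite mul0r.
  by have := normc_dist_trans w x z0; lra.
- exact: sdiff_cst.
Qed.

Lemma om_mul_L2 F F' B : 0 <= B -> (forall w, s <= normc (u w) -> hol F w (F' w)) ->
  (forall w, s <= normc (u w) -> normc (F w) <= B) ->
  L2 (fun w => (om w)%:C * F w) /\
  nrm2 (fun w => (om w)%:C * F w) <= (M * B) ^+ 2 * nrm2 (fun=> 1 : R[i]).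
Proof.
move=> B0 hF FB; apply: L2_bound (L2_cst 1) _.
  exact: cmeas_sdiff (om_mul_sdiff hF).
move=> w _; rewrite normc1 mulr1 normcM normc_real ger0_norm ?omega_ge0//.
have [sw|ws] := leP s (normc (u w)).
  apply: ler_pM => //; [exact: omega_ge0|exact: normc_ge0|exact: omega_le|exact: FB].
by have [-> _] := om_in (ltW ws); rewrite mul0r mulr_ge0// sqr_ge0.
Qed.

(* The junk value of [u^-n] at [u = 0] is harmless since [om] vanishes there. *)
Definition moment n w : R[i] := (om w)%:C * (u w) ^- n.

Let u0 w : s <= normc (u w) -> u w != 0.
Proof. by move=> h; apply/eqP => e; move: h; rewrite e normc0 leNgt s0. Qed.

Lemma moment_hol n w : s <= normc (u w) ->
  hol (fun w => (u w) ^- n) w (- n%:R * (u w) ^- n.+1).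
Proof. by move=> /u0; exact: hol_invX. Qed.

Lemma moment_L2 n : L2 (moment n) /\
  nrm2 (moment n) <= (M * s ^- n) ^+ 2 * nrm2 (fun=> 1 : R[i]).
Proof.
apply: om_mul_L2 (@moment_hol n) _; first by rewrite invr_ge0 exprn_ge0// ltW.
move=> w sw; rewrite normcV normcX lef_pV2 ?posrE ?exprn_gt0//.
  by rewrite lerXn2r ?nnegrE ?normc_ge0// ltW.
exact: lt_le_trans sw.
Qed.

Lemma L2_cintegrable F : L2 F -> cintegrable F.
Proof.
move=> LF; have := L2_dot LF (L2_cst 1); congr cintegrable.
by apply/funext => z; rewrite conjc1 mulr1.
Qed.

(* The rotation field [x d/dy - y d/dx] is a divergence, kills radial functions
   and multiplies [u^-n] by [- n i]. *)
Lemma moment_eq0 n : (0 < n)%N -> cintegral (moment n) = 0.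
Proof.
move=> n0; have sm := om_mul_sdiff (@moment_hol n).
have sRe w : sdiff (fun w => (complex.Re (u w))%:C) w 1 0.
  move=> e e0; exists 1 => // a b _ _.
  have -> : (complex.Re (u a))%:C - (complex.Re (u b))%:C - lin 1 0 (a - b) = 0.
    rewrite /lin mul1r mul0r addr0 !raddfB /=.
    by apply/eqP; rewrite eq_complex /=; apply/andP; split; apply/eqP; ring.
  by rewrite normc0 mulr_ge0 ?normc_ge0// ltW.
have sIm w : sdiff (fun w => (complex.Im (u w))%:C) w 0 1.
  move=> e e0; exists 1 => // a b _ _.
  have -> : (complex.Im (u a))%:C - (complex.Im (u b))%:C - lin 0 1 (a - b) = 0.
    rewrite /lin mul1r mul0r add0r !raddfB /=.
    by apply/eqP; rewrite eq_complex /=; apply/andP; split; apply/eqP; ring.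
  by rewrite normc0 mulr_ge0 ?normc_ge0// ltW.
have out w : normc z0 + 2 * s <= normc w -> moment n w = 0.
  by move=> /om_disk[_ h]; rewrite /moment h mul0r.
have [|cPa _ Pa _] := green z0s (fun w => sdiffM (sIm w) (sm w)).
  by move=> w /out; rewrite /moment => ->; rewrite mulr0.
have [|_ cQb _ Qb] := green z0s (fun w => sdiffM (sRe w) (sm w)).
  by move=> w /out; rewrite /moment => ->; rewrite mulr0.
(* With [x] and [y] the coordinates of [w - z0], this is the y-derivative of [x] times the moment
   minus the x-derivative of [y] times the moment: the rotation field as a divergence. The terms in
   [dom] cancel. *)
have := cintegralD cQb (cintegrableZ (-1) cPa).
rewrite cintegralZ// Pa Qb mulr0 addr0.
have mL : cintegrable (moment n) by apply: L2_cintegrable; have [] := moment_L2 n.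
rewrite (@eq_cintegral _ _ (fun w => (- n%:R * 'i) * moment n w)).
  rewrite cintegralZ// => /eqP; rewrite mulf_eq0 mulf_eq0 oppr_eq0 pnatr_eq0.
  rewrite -leqn0 leqNgt n0 /= => /orP[|/eqP//].
  by rewrite eq_complex /= oner_eq0 andbF.
move=> w _; rewrite /moment.
have [sw|ws] := leP s (normc (u w)); last first.
  by have [-> ->] := om_in (ltW ws); rewrite !(mul0r, mulr0, addr0).
have un := u0 sw.
have uE : u w = (complex.Re (u w))%:C + 'i * (complex.Im (u w))%:C by exact: complexE.
have -> : (u w) ^- n = u w * (u w) ^- n.+1.
  by rewrite exprS invfM mulrA mulfV// mul1r.
rewrite !(rmorphM _ (dom w)) /=.
set D := (dom w)%:C; set O := (om w)%:C; set k : R[i] := n%:R.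
set x := (complex.Re (u w))%:C in uE *; set y := (complex.Im (u w))%:C in uE *.
have i2 : 'i * 'i = -1 :> R[i] by rewrite -expr2 sqr_i.
set t := u w ^- n.+1; rewrite uE.
transitivity (- k * O * t * ('i * x + ('i * 'i) * y)).
  by rewrite i2; ring.
by ring.
Qed.

Lemma moment0_gt0 : exists2 c : R, 0 < c & cintegral (moment 0) = c%:C.
Proof.
exists (\int[dA]_(p in disk2) om (toC p)).
  have cm0 : cintegrable (moment 0) by apply: L2_cintegrable; have [] := moment_L2 0.
  have [m0 _] := cm0.
  have E : (fun p => (complex.Re (moment 0 (@toC R p)))%:E) = (fun p => (om (toC p))%:E).
    by apply/funext => p; rewrite /moment expr0 invr1 mulr1.
  rewrite E in m0.
  (* A point in the middle of the annulus, where [omega] is positive. *)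
  pose w : R[i] := z0 + (3 / 2 * s)%:C.
  have uw : u w = (3 / 2 * s)%:C by rewrite /w addrC addKr.
  have nuw : normc (u w) = 3 / 2 * s by rewrite uw normc_real ger0_norm// mulr_ge0// ltW.
  have om0 : 0 < om w.
    have /andP[_ r12'] := r12; apply: (omega_pos r12' erefl).
    rewrite nuw /r1 /r2 !exprMn; have := exprn_gt0 2 s0 => s2.
    by apply/andP; split; lra.
  have o2 : 0 < om w / 2 by rewrite divr_gt0.
  have [d d0 dP] := sdiff_cont (rsdiff_omega z0 r1 K w) o2.
  rewrite /Rintegral fine_gt0//; apply/andP; split; last first.
    by have := integrable_fin_num (@measurable_disk2 R) m0; rewrite fin_numE ltey => /andP[].
  apply: (@integral_disk_gt0 _ om w d (om w / 2)) => //.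
  - by have := measurable_int _ m0; move/measurable_EFinP.
  - by move=> z _; exact: omega_ge0.
  - apply/diskE; rewrite /w; apply: le_lt_trans (le_normcD _ _) _.
    rewrite normc_real ger0_norm; last by rewrite mulr_ge0// ?divr_ge0// ltW.
    by apply: le_lt_trans z0s; rewrite lerD2l ler_wpM2r// ?ltW//; lra.
  - move=> z zw; have [+ _] := dP z z zw zw.
    by rewrite -rmorphB normc_real => /ler_normlP[h1 h2]; lra.
rewrite /cintegral; congr Complex; first by
  apply: eq_Rintegral => p _; rewrite /moment expr0 invr1 mulr1.
rewrite (_ : 0 = \int[dA]_(p in @disk2 R) 0); last by rewrite /Rintegral integral0.
apply: eq_Rintegral => p _; rewrite /moment expr0 invr1 mulr1.
by [].
Qed.

(* Green's formula for the product of the cutoff and the difference quotient of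
   [h], which is holomorphic. *)
Lemma om_quot h z : analytic h -> normc (u z) < s ->
  cintegral (fun w => (om w)%:C * (u w * ((h w - h z) / (w - z)))) = 0.
Proof.
move=> ah zs; have Dz : disk z.
  by apply/diskE; have := normc_subD z z0; have := z0s; have := s0; lra.
have [a hH] := hol_quot ah Dz.
pose H w := if w == z then a else (h w - h z) / (w - z).
have [H' hH'] : exists H' : R[i] -> R[i], forall w, disk w -> hol H w (H' w).
  have : forall w, exists d, disk w -> hol H w d.
    by move=> w; have [/hH[d hd]|nD] := pselect (disk w); [exists d|exists 0].
  by move=> /choice[H' HH']; exists H'.
pose ex w := - 18 * K * om w * complex.Re (u w).
pose ey w := - 18 * K * om w * complex.Im (u w).
(* [H] is known to be holomorphic only on the disk. Near every point outside it the product with the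
   cutoff is 0, so its partial derivatives are set to 0 there. *)
pose P w := if `[< disk w >] then (ex w)%:C * H w + (et w)%:C * H' w else 0.
pose Q w := if `[< disk w >] then (ey w)%:C * H w + (et w)%:C * ('i * H' w) else 0.
have out w : normc z0 + 2 * s <= normc w -> (et w)%:C * H w = 0.
  by move=> /om_disk[-> _]; rewrite mul0r.
have sG w : sdiff (fun w => (et w)%:C * H w) w (P w) (Q w).
  rewrite /P /Q; case: asboolP => Dw.
    by apply: sdiffM (hH' _ Dw); exact: rsdiff_eta.
  have w1 : 1 <= normc w by rewrite leNgt; apply/negP => /diskE.
  apply: (@sdiff_eq _ (fun=> 0) _ _ _ _ (1 - (normc z0 + 2 * s))).
  - by rewrite subr_gt0.
  - move=> x xw; rewrite out//.
    by have := normc_subD w x; rewrite normc_sym; have := z0s; lra.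
  - exact: sdiff_cst.
have [cP cQ P0 Q0] := green z0s sG out.
(* [P + 'i * Q] is twice the d-bar derivative: the contribution of [H'] carries the factor
   [1 + 'i * 'i] and disappears, leaving the gradient of the cutoff times [H]. *)
have := cintegralD cP (cintegrableZ 'i cQ); rewrite cintegralZ// P0 Q0 mulr0 addr0.
have K0 : - 18 * K != 0.
  have /andP[_ r12'] := r12.
  by rewrite mulf_neq0 ?oppr_eq0// invr_neq0// expf_neq0// subr_eq0 gt_eqF.
move=> PQ0; have := cintegralZ ((- 18 * K)%:C)^-1 (cintegrableD cP (cintegrableZ 'i cQ)).
rewrite PQ0 mulr0 => <-; apply: eq_cintegral => w Dw.
rewrite /P /Q asboolT//.
have i2 : 'i * 'i = -1 :> R[i] by rewrite -expr2 sqr_i.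
have -> : (ex w)%:C * H w + (et w)%:C * H' w +
    'i * ((ey w)%:C * H w + (et w)%:C * ('i * H' w)) =
    ((ex w)%:C + 'i * (ey w)%:C) * H w.
  transitivity (((ex w)%:C + 'i * (ey w)%:C) * H w + (et w)%:C * H' w * (1 + 'i * 'i)).
    by ring.
  by rewrite i2 subrr mulr0 addr0.
have -> : (ex w)%:C + 'i * (ey w)%:C = (- 18 * K)%:C * ((om w)%:C * u w).
  have cM (x y : R) : (x * y)%:C = x%:C * y%:C :> R[i] by rewrite rmorphM.
  have uE : u w = (complex.Re (u w))%:C + 'i * (complex.Im (u w))%:C by exact: complexE.
  rewrite [in RHS]uE /ex /ey !(cM (- 18 * K * om w)).
  rewrite (cM (- 18 * K) (om w)); ring.
have Kc : (- 18 * K)%:C != 0 :> R[i] by rewrite eq_complex /= eqxx andbT.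
(* At [w = z] the filled value [a] and the default value of the quotient may differ, but [omega]
   vanishes there since [z] lies in the hole. *)
rewrite -!mulrA mulKf// /H; case: eqVneq => [->|wz]; last by [].
by have [->] := om_in (ltW zs); rewrite !mul0r.
Qed.

End BumpKernel.

Section L2Extra.
Context {R : realType}.
Implicit Types (f g : R[i] -> R[i]).

Lemma L2_conj f : L2 f -> L2 (fun z => (f z)^*%C) /\
  nrm2 (fun z => (f z)^*%C) <= nrm2 f.
Proof.
move=> Lf; have [] := @L2_bound _ f (fun z => (f z)^*%C) 1 _ Lf.
- exact: cmeas_conj (L2_cmeas Lf).
- by move=> z _; rewrite normc_conj mul1r.
- by rewrite expr1n mul1r.
Qed.

Lemma cauchy_schwarz_sqrt f g : L2 f -> L2 g ->
  normc (dotL2 f g) <= Num.sqrt (nrm2 f) * Num.sqrt (nrm2 g).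
Proof.
move=> Lf Lg; rewrite -sqrtrM ?nrm2_ge0//.
rewrite -[leLHS]ger0_norm ?normc_ge0// -sqrtr_sqr ler_wsqrtr//.
exact: cauchy_schwarz.
Qed.

Lemma pow2_small (A e : R) : 0 < e -> exists k, forall n, (k <= n)%N ->
  A * 2^-1 ^+ n <= e.
Proof.
move=> e0; exists (Num.bound (`|A| / e)) => n kn.
have h1 : `|A| / e < n%:R.
  apply: lt_le_trans (archi_boundP _) _; first by rewrite divr_ge0// ltW.
  by rewrite ler_nat.
have h2 : (n%:R : R) <= 2 ^+ n by rewrite -natrX ler_nat ltnW// ltn_expl.
rewrite exprVn ler_pdivrMr ?exprn_gt0//; apply: le_trans (ler_norm _) _.
rewrite mulrC -ler_pdivrMr//; apply: ltW; exact: lt_le_trans h2.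
Qed.

End L2Extra.

(** * Local expansions with a uniform remainder *)

Section Star.
Context {R : realType}.
Implicit Types (f g h : R[i] -> R[i]).

Lemma L2_dotL2_cst (a : R[i]) k : L2 k ->
  dotL2 (fun=> a) k = a * dotL2 (fun=> 1) k.
Proof.
move=> Lk; rewrite -dotL2Zl//; last exact: L2_cst.
by apply: eq_dotL2 => // z _; rewrite mulr1.
Qed.

Section At.
Context (z0 : R[i]) (s : R) (s0 : 0 < s) (z0s : normc z0 + 2 * s < 1).
Local Notation u w := (w - z0).
Local Notation mo := (moment z0 s).
(** Conjugated so that [dotL2 h (m n)] is the integral of [h] times the moment function [mo n]. *)
Let m n := fun w => (mo n w)^*%C.
Let M := ((2 * s) ^+ 2 - s ^+ 2) ^+ 2.
Let one2 := nrm2 (fun=> 1 : R[i]).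

Let Lm n : L2 (m n).
Proof. by have [/L2_conj[]] := moment_L2 z0 s0 n. Qed.

Let M0 : 0 <= M. Proof. exact: sqr_ge0. Qed.

Let m_nrm n : Num.sqrt (nrm2 (m n)) <= M * s ^- n * Num.sqrt one2.
Proof.
have [Lmo hm] := moment_L2 z0 s0 n.
have p0 : 0 <= M * s ^- n by rewrite mulr_ge0// invr_ge0 exprn_ge0// ltW.
rewrite -[M * s ^- n]ger0_norm// -sqrtr_sqr -sqrtrM ?sqr_ge0//.
rewrite ler_wsqrtr//; apply: le_trans hm.
by have [] := L2_conj Lmo.
Qed.

Let dot1 n : dotL2 (fun=> 1) (m n) = cintegral (mo n).
Proof. by apply: eq_cintegral => w _; rewrite mul1r conjcK. Qed.

Let term_le h v n : L2 h -> normc v <= s / 2 ->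
  normc (dotL2 h (m n) * v ^+ n) <=
  M * Num.sqrt one2 * Num.sqrt (nrm2 h) * 2^-1 ^+ n.
Proof.
move=> Lh vs; rewrite normcM normcX.
have sn : 0 < s ^+ n by rewrite exprn_gt0.
have hv : normc v ^+ n <= s ^+ n * 2^-1 ^+ n.
  by rewrite -exprMn lerXn2r ?nnegrE ?normc_ge0// divr_ge0// ltW.
apply: (@le_trans _ _ ((Num.sqrt (nrm2 h) * (M * s ^- n * Num.sqrt one2)) *
   (s ^+ n * 2^-1 ^+ n))).
  apply: ler_pM => //; rewrite ?exprn_ge0 ?normc_ge0//.
  apply: le_trans (cauchy_schwarz_sqrt Lh (Lm n)) _.
  by rewrite ler_wpM2l ?sqrtr_ge0.
rewrite le_eqVlt; apply/orP; left; apply/eqP; field.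
by rewrite gt_eqF.
Qed.

(** A finite geometric expansion with exact remainder, starting from [E 0 = 0], which is [om_quot].
    The constant [A] depends on [h z] through [g], so this only yields convergence; [tail] makes the
    rate uniform. *)
Let remainder h z : L2 h -> analytic h -> normc (u z) <= s / 2 ->
  exists A, forall N, (0 < N)%N ->
  normc (h z * cintegral (mo 0) - \sum_(n < N) dotL2 h (m n) * (u z) ^+ n) <=
    A * 2^-1 ^+ N.
Proof.
move=> Lh ah zs.
have zs1 : normc (u z) < s by have := s0; lra.
pose g w := h w - h z.
have Lg : L2 g by apply: L2_sub => //; exact: L2_cst.
pose F N w := (u w) ^- N * (u w / (w - z)).
pose psi N w := (omega z0 (s ^+ 2) (((2 * s) ^+ 2 - s ^+ 2) ^- 3) w)%:C * F N w.
(* Since [u z] has modulus at most [s / 2], hence at most half that of [u w], and [w - z] is the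
   difference of the two. *)
have wz w : s <= normc (u w) -> normc (u w) / 2 <= normc (w - z).
  move=> sw; have := normc_subD (u w) (u z).
  rewrite (_ : u w - u z = w - z); last by ring.
  by lra.
have wz0 w : s <= normc (u w) -> w - z != 0.
  move=> sw; apply/eqP => e; have := wz w sw; rewrite e normc0.
  by have := s0; lra.
have F_le N w : s <= normc (u w) -> normc (F N w) <= s ^- N * 2.
  move=> sw; have nu : 0 < normc (u w) by exact: lt_le_trans sw.
  rewrite /F !normcM !normcV normcX; apply: ler_pM.
  - by rewrite invr_ge0 exprn_ge0// ltW.
  - by rewrite divr_ge0// normc_ge0.
  - rewrite lef_pV2 ?posrE ?exprn_gt0//.
    by rewrite lerXn2r ?nnegrE ?normc_ge0// ltW.
  - rewrite ler_pdivrMr; first by have := wz w sw; lra.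
    by apply: lt_le_trans (wz w sw); rewrite divr_gt0.
have [Lpsi psi_le] : (forall N, L2 (psi N)) /\
    (forall N, nrm2 (psi N) <= (M * (s ^- N * 2)) ^+ 2 * one2).
  have sN0 N : 0 <= s ^- N by rewrite invr_ge0 exprn_ge0// ltW.
  have H N := om_mul_L2 s0 (mulr_ge0 (sN0 N) (ler0n R 2))
    (fun w (sw : s <= normc (u w)) => holM (moment_hol s0 N sw) (holM (hol_sub z0 w)
       (holV (hol_sub z w) (wz0 w sw)))) (F_le N).
  by split=> N; have [] := H N.
pose E N := dotL2 g (fun w => (psi N w)^*%C).
have LpsiC N : L2 (fun w => (psi N w)^*%C) by have [] := L2_conj (Lpsi N).
have E0 : E 0%N = 0.
  rewrite /E -(om_quot s0 z0s ah zs1); apply: eq_cintegral => w _.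
  by rewrite conjcK /psi /F expr0 invr1 /g; ring.
(* One geometric step: [u w / (w - z) = 1 + u z / (w - z)], multiplied by the power [u w ^- N]. *)
have ES N : E N = dotL2 g (m N) + u z * E N.+1.
  have -> : u z * E N.+1 = dotL2 g (fun w => (u z)^*%C * (psi N.+1 w)^*%C).
    by rewrite dotL2Zr// conjcK.
  rewrite -dotL2Dr//; last exact: L2_scale.
  apply: eq_dotL2 => // w _; rewrite -rmorphM -rmorphD /m /psi /moment /F.
  congr (_^*%C); have [sw|ws] := leP s (normc (u w)); last first.
    by have [-> _] := om_in s0 (ltW ws); rewrite !(mul0r, mulr0) addr0.
  have u0 : u w != 0.
    by apply/eqP => e; move: sw; rewrite e normc0 leNgt s0.
  have := wz0 w sw => w0; have uN : u w ^+ N != 0 by rewrite expf_neq0.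
  rewrite (exprS (u w) N); move: uN; set t := u w ^+ N; set O := (omega _ _ _ _)%:C => t0.
  by field; rewrite w0 u0 t0.
have sumE N : \sum_(n < N) dotL2 g (m n) * (u z) ^+ n = - ((u z) ^+ N * E N).
  elim: N => [|N ih]; first by rewrite big_ord0 E0 mulr0 oppr0.
  by rewrite big_ord_recr /= ih ES exprSr; ring.
exists (Num.sqrt (nrm2 g) * (M * 2 * Num.sqrt one2)) => -[//|N] _.
(* Replacing [g] by [h] changes only the term [n = 0], because the higher moments vanish; that term
   is present as the order is positive. *)
have -> : h z * cintegral (mo 0) - \sum_(n < N.+1) dotL2 h (m n) * (u z) ^+ n =
   (u z) ^+ N.+1 * E N.+1.
  have dgm n : dotL2 g (m n) = dotL2 h (m n) - h z * dotL2 (fun=> 1) (m n).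
    by rewrite -(L2_dotL2_cst (h z) (Lm n)) -(dotL2Bl Lh (L2_cst (h z)) (Lm n)).
  rewrite -[RHS]opprK -sumE; under [in RHS]eq_bigr do rewrite dgm mulrBl.
  rewrite sumrB opprB; congr (_ - _).
  rewrite big_ord_recl big1 ?addr0 ?expr0 ?mulr1 ?dot1// => i _.
  by rewrite dot1 moment_eq0// mulr0 mul0r.
have sN : 0 < s ^+ N.+1 by rewrite exprn_gt0.
rewrite normcM normcX.
have hv : normc (u z) ^+ N.+1 <= s ^+ N.+1 * 2^-1 ^+ N.+1.
  rewrite -exprMn lerXn2r ?nnegrE ?normc_ge0// divr_ge0// ltW//.
have hE : normc (E N.+1) <= Num.sqrt (nrm2 g) * (M * (s ^- N.+1 * 2) * Num.sqrt one2).
  apply: le_trans (cauchy_schwarz_sqrt Lg (LpsiC _)) _.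
  rewrite ler_wpM2l ?sqrtr_ge0//.
  have p0 : 0 <= M * (s ^- N.+1 * 2) by rewrite mulr_ge0// mulr_ge0// invr_ge0 ltW.
  rewrite -[M * _]ger0_norm// -sqrtr_sqr -sqrtrM ?sqr_ge0//.
  rewrite ler_wsqrtr//; apply: le_trans (psi_le _).
  by have [] := L2_conj (Lpsi N.+1).
apply: (@le_trans _ _ ((s ^+ N.+1 * 2^-1 ^+ N.+1) *
  (Num.sqrt (nrm2 g) * (M * (s ^- N.+1 * 2) * Num.sqrt one2)))).
  by apply: ler_pM => //; rewrite ?exprn_ge0 ?normc_ge0.
rewrite le_eqVlt; apply/orP; left; apply/eqP; field.
by rewrite gt_eqF.
Qed.

(** The remainder at a much higher order is negligible, and the terms in between are bounded by
    Cauchy-Schwarz in terms of [nrm2 h] alone. The resulting constant depends neither on [z] nor on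
    [h z]. *)
Let tail h z N : L2 h -> analytic h -> normc (u z) <= s / 2 ->
  normc (h z * cintegral (mo 0) - \sum_(n < N) dotL2 h (m n) * (u z) ^+ n) <=
    2 * (M * Num.sqrt one2 * Num.sqrt (nrm2 h)) * 2^-1 ^+ N.
Proof.
move=> Lh ah zs; set B := M * _ * _; have B0 : 0 <= B.
  by rewrite mulr_ge0 ?sqrtr_ge0// mulr_ge0// sqrtr_ge0.
have [A hA] := remainder Lh ah zs.
apply/ler_addgt0Pl => e /(pow2_small A)[k hk].
have := hA (N + k).+1 (ltn0Sn _) => h1.
have := hk (N + k).+1 (leqW (leq_addl _ _)) => h2.
set S := \sum_(n < N) _; set T := \sum_(n < (N + k).+1) _ in h1.
have TS : normc (T - S) <= 2 * B * 2^-1 ^+ N.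
  have -> : T - S = \sum_(i < k.+1) dotL2 h (m (N + i)) * (u z) ^+ (N + i).
    have -> : T = S + \sum_(i < k.+1) dotL2 h (m (N + i)) * (u z) ^+ (N + i).
      by rewrite /T -addnS big_split_ord.
    by rewrite addrC addKr.
  apply: le_trans (normc_sum _ _ _) _.
  apply: (@le_trans _ _ (\sum_(i < k.+1) B * 2^-1 ^+ N * 2^-1 ^+ i)).
    by apply: ler_sum => i _; rewrite -mulrA -exprD; exact: term_le.
  rewrite -mulr_sumr [leRHS](_ : _ = B * 2^-1 ^+ N * 2); last by ring.
  rewrite ler_wpM2l ?sum_half_le//.
  by rewrite mulr_ge0// exprn_ge0// invr_ge0.
rewrite (_ : h z * _ - S = (h z * cintegral (mo 0) - T) + (T - S)); last by ring.
apply: le_trans (le_normcD _ _) _; apply: lerD => //.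
exact: le_trans h2.
Qed.

Lemma star_at : exists (C : R) (kap : nat -> R[i] -> R[i]),
  [/\ 0 <= C, forall n, L2 (kap n) & forall h v N, L2 h -> analytic h ->
   normc v <= s / 2 -> normc (h (z0 + v) - \sum_(n < N) dotL2 h (kap n) * v ^+ n) <=
    C * Num.sqrt (nrm2 h) * 2^-1 ^+ N].
Proof.
have [c c0 cE] := moment0_gt0 s0 z0s.
exists (2 * (M * Num.sqrt one2) / c), (fun n w => (c^-1)%:C * m n w); split.
- by rewrite divr_ge0 ?(ltW c0)// mulr_ge0// mulr_ge0// sqrtr_ge0.
- by move=> n; exact: L2_scale.
move=> h v N Lh ah vs.
have vE : u (z0 + v) = v by rewrite addrC addKr.
have := @tail h (z0 + v) N Lh ah; rewrite vE cE => /(_ vs) ht.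
have cc : c%:C != 0 :> R[i] by rewrite eq_complex /= eqxx andbT gt_eqF.
have -> : h (z0 + v) - \sum_(n < N) dotL2 h (fun w => (c^-1)%:C * m n w) * v ^+ n =
  (c^-1)%:C * (h (z0 + v) * c%:C - \sum_(n < N) dotL2 h (m n) * v ^+ n).
  rewrite mulrBr mulrCA fmorphV mulVf// mulr1; congr (_ - _).
  rewrite mulr_sumr; apply: eq_bigr => n _.
  by rewrite dotL2Zr// -fmorphV conjc_real mulrA.
rewrite normcM normc_real gtr0_norm ?invr_gt0// mulrC ler_pdivrMr//.
apply: le_trans ht _; rewrite le_eqVlt; apply/orP; left; apply/eqP; field.
by rewrite gt_eqF.
Qed.

End At.

(* Uniform local power series expansion with coefficients that are bounded
   functionals on L^2: this is what makes the Bergman space complete. *)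
Lemma star (z0 : R[i]) : disk z0 -> exists (s C : R) (kap : nat -> R[i] -> R[i]),
  [/\ 0 < s, 0 <= C, forall n, L2 (kap n) & forall h v N, L2 h -> analytic h ->
   normc v <= s -> normc (h (z0 + v) - \sum_(n < N) dotL2 h (kap n) * v ^+ n) <=
    C * Num.sqrt (nrm2 h) * 2^-1 ^+ N].
Proof.
(* This gives [normc z0 + 2 * s = (1 + normc z0) / 2], which is below 1. *)
move=> /diskE Dz; pose s := (1 - normc z0) / 4.
have s0 : 0 < s by rewrite divr_gt0// subr_gt0.
have [|C [kap [? ? ?]]] := @star_at z0 s s0; first by rewrite /s; lra.
by exists (s / 2), C, kap; split=> //; rewrite divr_gt0.
Qed.

End Star.

(** * Completeness and the Bergman projection *)

Section Completeness.
Context {R : realType}.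
Implicit Types (f g h k : R[i] -> R[i]) (z v : R[i]).

Definition tends (x : nat -> R[i]) (l : R[i]) := forall e : R, 0 < e ->
  exists K, forall i, (K <= i)%N -> normc (x i - l) <= e.

Lemma ccauchy_tends (x : nat -> R[i]) : (forall e : R, 0 < e -> exists K,
    forall i j, (K <= i)%N -> (K <= j)%N -> normc (x i - x j) <= e) ->
  exists l, tends x l.
Proof.
move=> cx; have H (u : nat -> R) : (forall e : R, 0 < e -> exists K,
    forall i j, (K <= i)%N -> (K <= j)%N -> `|u i - u j| <= e) ->
    exists l, forall e : R, 0 < e -> exists K, forall i, (K <= i)%N -> `|u i - l| <= e.
  move=> cu; have cvu : cvgn u.
    apply/cauchy_cvgP/cauchy_ballP => e e0.
    have e2 : 0 < e / 2 by rewrite divr_gt0.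
    have [K hK] := cu _ e2; rewrite near_simpl.
    exists ([set i | (K <= i)%N], [set i | (K <= i)%N]).
      by split; exists K.
    move=> [i j] [/= Ki Kj]; rewrite /ball /=.
    by apply: le_lt_trans (hK _ _ Ki Kj) _; lra.
  exists (limn u) => e e0; have /cvgrPdist_le/(_ _ e0)[K _ hK] := cvu.
  by exists K => i /hK; rewrite distrC.
have [|a ha] := H (fun i => complex.Re (x i)).
  move=> e /cx[K hK]; exists K => i j Ki Kj; rewrite -raddfB.
  by apply: le_trans (absRe_le_normc _) _; exact: hK.
have [|b hb] := H (fun i => complex.Im (x i)).
  move=> e /cx[K hK]; exists K => i j Ki Kj; rewrite -raddfB.
  by apply: le_trans (absIm_le_normc _) _; exact: hK.
exists (a +i* b) => e e0; have e2 : 0 < e / 2 by rewrite divr_gt0.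
have [K hK] := ha _ e2; have [L hL] := hb _ e2.
exists (maxn K L) => i; rewrite geq_max => /andP[Ki Li].
apply: le_trans (normc_leReIm _) _; rewrite !raddfB /=.
by rewrite [e]splitr; apply: lerD; [exact: hK|exact: hL].
Qed.

Lemma tendsD x y a b : tends x a -> tends y b -> tends (fun i => x i + y i) (a + b).
Proof.
move=> xa yb e e0; have e2 : 0 < e / 2 by rewrite divr_gt0.
have [K hK] := xa _ e2; have [L hL] := yb _ e2.
exists (maxn K L) => i; rewrite geq_max => /andP[Ki Li].
rewrite opprD addrACA; apply: le_trans (le_normcD _ _) _.
by rewrite [e]splitr; apply: lerD; [exact: hK|exact: hL].
Qed.

Lemma tendsZ x a c : tends x a -> tends (fun i => x i * c) (a * c).
Proof.
move=> xa e e0; have c1 : 0 < normc c + 1 by have := normc_ge0 c; lra.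
have [|K hK] := xa (e / (normc c + 1)); first by rewrite divr_gt0.
exists K => i Ki; rewrite -mulrBl normcM.
apply: (@le_trans _ _ (e / (normc c + 1) * (normc c + 1))).
  apply: ler_pM; [exact: normc_ge0|exact: normc_ge0|exact: hK|lra].
by rewrite divfK// gt_eqF.
Qed.

Lemma tends_sum N (x : nat -> nat -> R[i]) (a : nat -> R[i]) :
  (forall n, tends (x^~ n) (a n)) ->
  tends (fun i => \sum_(n < N) x i n) (\sum_(n < N) a n).
Proof.
move=> xa; elim: N => [|N ih].
  move=> e e0; exists 0%N => i _; rewrite !big_ord0 subrr normc0; exact: ltW.
rewrite big_ord_recr /=; under eq_fun do rewrite big_ord_recr /=.
exact: tendsD.
Qed.

Lemma tends_le x l (y : R[i]) (B : R) : tends x l ->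
  (forall i, normc (x i - y) <= B) -> normc (l - y) <= B.
Proof.
move=> xl xB; apply/ler_addgt0Pl => e /xl[K /(_ K (leqnn _)) hK].
rewrite (_ : l - y = - (x K - l) + (x K - y)); last by ring.
by apply: le_trans (le_normcD _ _) _; rewrite normcN; apply: lerD.
Qed.

Lemma analyticB f g : analytic f -> analytic g -> analytic (fun z => f z - g z).
Proof.
move=> af ag; have := @analyticZD _ (-1) g f ag af.
congr analytic; apply/funext => z.
by rewrite addrC /= -[((_ : R[i] -> R[i]^o) + _) z]/(f z + -1 * g z) mulN1r.
Qed.

(** Bounded functionals turn a Cauchy sequence in norm into convergent values and convergent
    coefficients. The remainder bound of [star] is uniform along the sequence, so it survives the
    pointwise limit and gives a power series for [g]. *)
Lemma bergman_limit (h : nat -> R[i] -> R[i]) (B : R) :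
  (forall i, L2 (h i)) -> (forall i, analytic (h i)) ->
  (forall i, nrm2 (h i) <= B) ->
  (forall e : R, 0 < e -> exists K, forall i j, (K <= i)%N -> (K <= j)%N ->
     nrm2 (fun z => h i z - h j z) <= e) ->
  exists g, [/\ analytic g, forall z, ~ disk z -> g z = 0 &
    forall z, disk z -> tends (h^~ z) (g z)].
Proof.
move=> Lh ah hB hc.
have lim z : exists l, (disk z -> tends (h^~ z) l) /\ (~ disk z -> l = 0).
  have [Dz|nDz] := pselect (disk z); last by exists 0.
  have [s [C [kap [s0 C0 Lk st]]]] := star Dz.
  have [|l hl] := @ccauchy_tends (h^~ z); last by exists l.
  move=> e e0; have C1 : 0 < C + 1 by lra.
  have d0 : 0 < (e / (C + 1)) ^+ 2 by rewrite exprn_gt0// divr_gt0.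
  have [K hK] := hc _ d0; exists K => i j Ki Kj.
  (* The instance [v = 0], [N = 0] of [star] says that point evaluation is bounded. *)
  have := st (fun z => h i z - h j z) 0 0%N (L2_sub (Lh i) (Lh j))
    (analyticB (ah i) (ah j)).
  rewrite normc0 => /(_ (ltW s0)); rewrite big_ord0 subr0 addr0 expr0 mulr1.
  move/le_trans; apply; apply: (@le_trans _ _ ((C + 1) * (e / (C + 1)))); last first.
    by rewrite mulrC divfK// gt_eqF.
  apply: ler_pM => //; rewrite ?sqrtr_ge0//; first by lra.
  have p0 : 0 <= e / (C + 1) by rewrite divr_ge0// ltW.
  rewrite -[leRHS]ger0_norm// -sqrtr_sqr ler_wsqrtr//.
  exact: hK.
have [g gP] := choice lim; exists g; split; last 2 first.
- by move=> z; case: (gP z).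
- by move=> z; case: (gP z).
apply/analytic_powser => z0 Dz0.
have [s [C [kap [s0 C0 Lk st]]]] := star Dz0.
have coef n : exists a, tends (fun i => dotL2 (h i) (kap n)) a.
  apply: ccauchy_tends => e e0.
  have k1 : 0 < Num.sqrt (nrm2 (kap n)) + 1 by have := sqrtr_ge0 (nrm2 (kap n)); lra.
  have d0 : 0 < (e / (Num.sqrt (nrm2 (kap n)) + 1)) ^+ 2 by rewrite exprn_gt0// divr_gt0.
  have [K hK] := hc _ d0; exists K => i j Ki Kj.
  rewrite -(dotL2Bl (Lh i) (Lh j) (Lk n)).
  apply: le_trans (cauchy_schwarz_sqrt (L2_sub (Lh i) (Lh j)) (Lk n)) _.
  apply: (@le_trans _ _ ((e / (Num.sqrt (nrm2 (kap n)) + 1)) * (Num.sqrt (nrm2 (kap n)) + 1))).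
    apply: ler_pM; rewrite ?sqrtr_ge0//; last by lra.
    have p0 : 0 <= e / (Num.sqrt (nrm2 (kap n)) + 1) by rewrite divr_ge0// ltW.
    rewrite -[leRHS]ger0_norm// -sqrtr_sqr ler_wsqrtr//.
    exact: hK.
  by rewrite divfK// gt_eqF.
have [a aP] := choice coef.
have Dz := Dz0; move/diskE in Dz.
pose r := Num.min s (1 - normc z0).
have r0 : 0 < r by rewrite lt_min s0 subr_gt0.
exists a, r; split=> // v; rewrite lt_min => /andP[vs vz] e e0.
have Dv : disk (z0 + v).
  by apply/diskE; apply: le_lt_trans (le_normcD _ _) _; lra.
have key N : normc (g (z0 + v) - \sum_(n < N) a n * v ^+ n) <=
    C * Num.sqrt B * 2^-1 ^+ N.
  have T : tends (fun i => h i (z0 + v) + (\sum_(n < N) dotL2 (h i) (kap n) * v ^+ n) * -1)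
      (g (z0 + v) + (\sum_(n < N) a n * v ^+ n) * -1).
    apply: tendsD; first by have [H _] := gP (z0 + v); exact: H.
    apply: (tendsZ (x := fun i => \sum_(n < N) dotL2 (h i) (kap n) * v ^+ n)).
    exact: (tends_sum N (fun n => tendsZ (v ^+ n) (aP n))).
  have Tb i : normc (h i (z0 + v) + (\sum_(n < N) dotL2 (h i) (kap n) * v ^+ n) * -1 - 0)
      <= C * Num.sqrt B * 2^-1 ^+ N.
    rewrite subr0 mulrN1; apply: le_trans (st _ _ N (Lh i) (ah i) (ltW vs)) _.
    rewrite ler_wpM2r ?exprn_ge0 ?invr_ge0//.
    by rewrite ler_wpM2l// ler_wsqrtr.
  by have := tends_le T Tb; rewrite subr0 mulrN1.
have [N hN] := pow2_small (C * Num.sqrt B) e0.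
by exists N => n /hN; exact: le_trans.
Qed.

End Completeness.

(** * Nearest points and orthogonality *)

Section Projection.
Context {R : realType}.
Implicit Types (f g h k : R[i] -> R[i]) (z v : R[i]).

Lemma tends_cvg (F : R[i] -> R) (x : nat -> R[i]) l :
  (forall a b, `|F a - F b| <= normc (a - b)) -> tends x l ->
  F (x i) @[i --> \oo] --> F l.
Proof.
move=> FL xl; apply/cvgrPdist_le => e /xl[K hK]; exists K => // i /= /hK.
by rewrite distrC => /(le_trans (FL _ _)).
Qed.

Lemma normc_lip (a b : R[i]) : `|normc a - normc b| <= normc (a - b).
Proof.
rewrite ler_norml normc_subD andbT lerNl opprB normc_sym; exact: normc_subD.
Qed.

(** The minimizing sequence is controlled pointwise, so Fatou's lemma gives both the norm inequality
    and membership of the limit, the latter by writing [g] as [f - (f - g)]. *)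
Lemma fatou_nrm2 f g (h : nat -> R[i] -> R[i]) (d : R) : L2 f ->
  (forall i, L2 (h i)) -> (forall z, disk z -> tends (h^~ z) (g z)) ->
  (nrm2 (fun z => f z - h i z) @[i --> \oo] --> d) ->
  L2 g /\ nrm2 (fun z => f z - g z) <= d.
Proof.
move=> Lf Lh hg hd.
have mg : cmeas g.
  split.
  - apply: (@measurable_fun_cvg _ _ _ _ (fun i p => complex.Re (h i (toC p)))).
      by move=> i; case: (L2_cmeas (Lh i)).
    move=> p Dp; apply: (@tends_cvg (@complex.Re R) (h^~ (toC p))); last exact: hg.
    by move=> a b; rewrite -raddfB; exact: absRe_le_normc.
  - apply: (@measurable_fun_cvg _ _ _ _ (fun i p => complex.Im (h i (toC p)))).
      by move=> i; case: (L2_cmeas (Lh i)).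
    move=> p Dp; apply: (@tends_cvg (@complex.Im R) (h^~ (toC p))); last exact: hg.
    by move=> a b; rewrite -raddfB; exact: absIm_le_normc.
have mfg : cmeas (fun z => f z - g z) by apply: cmeasB => //; exact: L2_cmeas.
pose F i p := (normc (f (@toC R p) - h i (toC p)) ^+ 2)%:E.
have mF i : measurable_fun disk2 (F i) by exact: measurable_normc2 (L2_sub Lf (Lh i)).
have F0 i p : disk2 p -> (0 <= F i p)%E by move=> _; rewrite lee_fin sqr_ge0.
have := @fatou _ _ _ (@dA R) disk2 (@measurable_disk2 R) F mF F0.
have -> : (fun n => \int[dA]_(p in disk2) F n p)%E =
    (fun n => (nrm2 (fun z => f z - h n z))%:E).
  by apply/funext => n; rewrite nrm2_EFin//; exact: L2_sub.
have cd : (nrm2 (fun z => f z - h i z))%:E @[i --> \oo] --> d%:E.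
  by apply/fine_cvgP; split; [exact: nearW|exact: hd].
have [-> _] := cvg_limn_einf_sup cd.
rewrite (eq_integral (fun p => (normc (f (toC p) - g (toC p)) ^+ 2)%:E)); last first.
  move=> p; rewrite inE => Dp.
  have c1 : normc (f (toC p) - h i (toC p)) @[i --> \oo] --> normc (f (toC p) - g (toC p)).
    apply: (@tends_cvg (fun a => normc (f (toC p) - a)) (h^~ (toC p))); last exact: hg.
    move=> a b; apply: le_trans (normc_lip _ _) _; rewrite (normc_sym a b).
    by rewrite (_ : _ - _ - _ = b - a)//; ring.
  have c2 : F i p @[i --> \oo] --> (normc (f (toC p) - g (toC p)) ^+ 2)%:E.
    apply/fine_cvgP; split; first exact: nearW.
    exact: (cvgM c1 c1).
  by have [-> _] := cvg_limn_einf_sup c2.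
move=> le_d.
have Lfg : L2 (fun z => f z - g z).
  by case: mfg => m1 m2; split=> //; apply: le_lt_trans le_d _; rewrite ltry.
split; last by rewrite -lee_fin nrm2_EFin.
rewrite (_ : g = fun z => f z - (f z - g z)); first exact: L2_sub.
by apply/funext => z; ring.
Qed.

Definition in_bergman h := [/\ L2 h, analytic h & forall z, ~ disk z -> h z = 0].

Lemma in_bergmanP h : in_bergman h <-> (h : R[i] -> R[i]^o) \in bergman_pred.
Proof. by split=> [H|/asboolP//]; apply/asboolP. Qed.

Lemma in_bergmanZD (c : R[i]) h k : in_bergman h -> in_bergman k ->
  in_bergman (fun z => c * h z + k z).
Proof.
move=> [Lh ah h0] [Lk ak k0]; split.
- by apply: L2_add => //; exact: L2_scale.
- exact: (@analyticZD _ c h k ah ak).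
- by move=> z Dz; rewrite h0// k0// mulr0 addr0.
Qed.

Lemma in_bergman0 : in_bergman (fun=> 0).
Proof. by split=> //; [exact: L2_cst|exact: analytic0]. Qed.

Lemma parallelogram f g : L2 f -> L2 g ->
  nrm2 (fun z => f z + g z) + nrm2 (fun z => f z - g z) = 2 * (nrm2 f + nrm2 g).
Proof. by move=> Lf Lg; rewrite nrm2D// nrm2B//; ring. Qed.

Lemma closest_point f : L2 f -> exists2 g, in_bergman g &
  forall h, in_bergman h -> nrm2 (fun z => f z - g z) <= nrm2 (fun z => f z - h z).
Proof.
move=> Lf.
pose S : set R := [set x | exists2 h, in_bergman h & x = nrm2 (fun z => f z - h z)].
have S0 : S !=set0 by exists (nrm2 (fun z => f z - 0)), (fun=> 0) => //; exact: in_bergman0.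
have Slb : has_lbound S by exists 0 => _ [h _ ->]; exact: nrm2_ge0.
have Sinf : has_inf S by split.
pose d := inf S.
have d_le h : in_bergman h -> d <= nrm2 (fun z => f z - h z).
  by move=> bh; apply: ge_inf => //; exists h.
have [h hP] : exists h : nat -> R[i] -> R[i], forall n, in_bergman (h n) /\
    nrm2 (fun z => f z - h n z) <= d + 2^-1 ^+ n.
  have : forall n, exists h, in_bergman h /\ nrm2 (fun z => f z - h z) <= d + 2^-1 ^+ n.
    move=> n; have e0 : 0 < (2^-1 : R) ^+ n by rewrite exprn_gt0.
    have [_ [h bh ->] hx] := inf_adherent e0 Sinf.
    by exists h; split=> //; exact: ltW.
  by move=> /choice[h hP]; exists h.
have bh n : in_bergman (h n) by case: (hP n).
have Lh n : L2 (h n) by case: (bh n).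
have Lfh n : L2 (fun z => f z - h n z) by exact: L2_sub.
have dle n : nrm2 (fun z => f z - h n z) <= d + 2^-1 ^+ n by case: (hP n).
have half n : (2^-1 : R) ^+ n <= 1 by apply: exprn_ile1; lra.
have cauchy e : 0 < e -> exists K, forall i j, (K <= i)%N -> (K <= j)%N ->
    nrm2 (fun z => h i z - h j z) <= e.
  (* The midpoint is at squared distance at least [d] from [f], so the parallelogram law bounds the
     left side by twice the sum of the two errors, each at most [e / 4]. *)
  move=> /(pow2_small 4)[K hK]; exists K => i j Ki Kj.
  have := parallelogram (Lfh i) (Lfh j).
  rewrite [X in _ + X](@eq_nrm2 _ _ (fun z => -1 * (h i z - h j z))); last first.
    by move=> z _; ring.
  rewrite nrm2Z ?normcN ?normc1 ?expr1n ?mul1r; last exact: L2_sub.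
  rewrite [X in X + _](@eq_nrm2 _ _ (fun z => 2 * (f z - (2^-1 * h i z + 2^-1 * h j z)))); last first.
    by move=> z _; field.
  have bm : in_bergman (fun z => 2^-1 * h i z + 2^-1 * h j z).
    apply: in_bergmanZD => //.
    have -> : (fun z => 2^-1 * h j z) = (fun z => 2^-1 * h j z + 0).
      by apply/funext => z; rewrite addr0.
    by apply: in_bergmanZD => //; exact: in_bergman0.
  have Lm : L2 (fun z => 2^-1 * h i z + 2^-1 * h j z) by case: bm.
  have dm := d_le _ bm.
  rewrite nrm2Z; last exact: L2_sub.
  have -> : normc (2 : R[i]) ^+ 2 = 4.
    have -> : (2 : R[i]) = (2 : R)%:C by rewrite rmorph_nat.
    by rewrite normc_real ger0_norm//; ring.
  have := hK _ Ki; have := hK _ Kj; have := dle i; have := dle j.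
  lra.
have bnd n : nrm2 (h n) <= 2 * (nrm2 f + (d + 1)).
  rewrite (@eq_nrm2 _ _ (fun z => f z + -1 * (f z - h n z))); last first.
    by move=> z _; ring.
  apply: le_trans (nrm2D_le Lf (@L2_scale _ (-1) _ (Lfh n))) _.
  rewrite nrm2Z// normcN normc1 expr1n mul1r.
  by have := dle n; have := half n; lra.
have [g [ag g0 hg]] := bergman_limit Lh (fun n => (fun '(And3 _ a _) => a) (bh n)) bnd cauchy.
have cd : nrm2 (fun z => f z - h n z) @[n --> \oo] --> d.
  apply/cvgrPdist_le => e /(pow2_small 1)[K hK]; exists K => // n /= /hK.
  rewrite mul1r => hn; rewrite distrC ger0_norm ?subr_ge0 ?d_le//.
  by have := dle n; lra.
have [Lg gd] := fatou_nrm2 Lf Lh hg cd.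
by exists g => [//|k /d_le]; exact: le_trans.
Qed.

Lemma closest_point_orth f g k : L2 f -> in_bergman g -> in_bergman k ->
  (forall h, in_bergman h -> nrm2 (fun z => f z - g z) <= nrm2 (fun z => f z - h z)) ->
  dotL2 (fun z => f z - g z) k = 0.
Proof.
move=> Lf bg bk gmin; have [Lg _ _] := bg; have [Lk _ _] := bk.
have Lfg := L2_sub Lf Lg; set e := fun z => f z - g z in Lfg *.
(* [g] is perturbed by [t D k]. As [t * nrm2 k <= 1], the quadratic term is at most [t * N] while
   the linear one is [- 2 * t * N], and minimality forces [N = 0]. *)
set D := dotL2 e k; pose t := (nrm2 k + 1)^-1.
have k0 := nrm2_ge0 k; have t0 : 0 < t by rewrite invr_gt0; lra.
have := gmin _ (in_bergmanZD (t%:C * D) bk bg).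
rewrite [leRHS](@eq_nrm2 _ _ (fun z => e z - (t%:C * D) * k z)); last first.
  by move=> z _; rewrite /e; ring.
rewrite (nrm2B Lfg (@L2_scale _ (t%:C * D) _ Lk)) (nrm2Z _ Lk) (dotL2Zr _ Lk Lfg).
rewrite -/D normcM normc_real (gtr0_norm t0) exprMn.
have -> : complex.Re ((t%:C * D)^*%C * D) = t * normc D ^+ 2.
  by rewrite normc2E; case: (D) => a b /=; ring.
rewrite -/e => h; apply/normc_eq0P; set N := normc D ^+ 2 in h.
have N0 : 0 <= N by exact: sqr_ge0.
have tk : t * nrm2 k <= 1.
  by rewrite /t mulrC ler_pdivrMr; lra.
have : t * N <= 0.
  have : t * N * (t * nrm2 k) <= t * N by rewrite ler_piMr// mulr_ge0// ltW.
  move: h; rewrite (_ : t ^+ 2 * N * nrm2 k = t * N * (t * nrm2 k)); last by ring.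
  by lra.
rewrite pmulr_rle0// => N1; have : N == 0 by rewrite eq_le N1 N0.
by rewrite sqrf_eq0 => /eqP.
Qed.

Lemma bergman_proj_ex f : L2 f -> exists h : bergman R,
  forall k : bergman R, dotL2 (fun z => f z - h z) k = 0.
Proof.
move=> Lf; have [g bg gmin] := closest_point Lf.
exists (Bergman ((in_bergmanP g).1 bg)) => k.
exact: closest_point_orth Lf bg ((in_bergmanP k).2 (bergmanP k)) gmin.
Qed.

End Projection.

(** * Kernels of Toeplitz operators *)

Section Symbol.
Context {R : realType}.
Implicit Types (f g h k : R[i] -> R[i]) (z w : R[i]).

Lemma sdiff_conj_comp f z p q : sdiff f z p q ->
  sdiff (fun w => (f w)^*%C) z p^*%C q^*%C.
Proof.
move=> sf e /sf; apply: near2_sub => a b; rewrite -[leLHS]normc_conj.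
by rewrite /lin !rmorphB rmorphD !rmorphM /= !oppr0.
Qed.

Lemma holX n z : hol (fun w => w ^+ n) z (n%:R * z ^+ n.-1).
Proof.
elim: n => [|n ih]; first by rewrite mul0r; exact: hol_cst.
have := holM (hol_id z) ih.
under eq_fun do rewrite -exprS.
congr hol; rewrite mul1r mulrCA -[in LHS]/(id z).
case: n {ih} => [|n]; first by rewrite mul0r addr0 mul1r.
by rewrite -exprS -[in RHS]natr1 mulrDl mul1r addrC.
Qed.

Section Phi.
Context (m : nat) (alpha beta gamma : R[i]).

Definition symb z : R[i] := gamma * z^*%C ^+ m + alpha * z ^+ m + beta.

Let d z : R[i] := m%:R * z ^+ m.-1.

Lemma sdiff_symb z : sdiff symb z (gamma * (d z)^*%C + alpha * d z)
  (gamma * ('i * d z)^*%C + alpha * ('i * d z)).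
Proof.
have h := holX m z.
have hc : sdiff (fun w => w^*%C ^+ m) z (d z)^*%C ('i * d z)^*%C.
  by have := sdiff_conj_comp h; under eq_fun do rewrite rmorphXn /=.
have := sdiffD (sdiffD (sdiff_scale gamma hc) (sdiff_scale alpha h))
  (sdiff_cst beta z).
by rewrite !addr0.
Qed.

Lemma cmeas_symb : cmeas symb.
Proof. exact: cmeas_sdiff sdiff_symb. Qed.

Definition symb_bound : R := normc gamma + normc alpha + normc beta.

Lemma symb_le z : disk z -> normc (symb z) <= symb_bound.
Proof.
move=> /diskE z1; have n0 := @normc_ge0 R.
apply: le_trans (le_normcD _ _) _; apply: lerD => //.
have zm : normc z ^+ m <= 1 by rewrite exprn_ile1// ltW.
apply: le_trans (le_normcD _ _) _; rewrite !normcM !normcX normc_conj.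
by apply: lerD; rewrite ler_piMr.
Qed.

Lemma symb_L2 f : L2 f -> L2 (fun z => symb z * f z) /\
  nrm2 (fun z => symb z * f z) <= symb_bound ^+ 2 * nrm2 f.
Proof.
move=> Lf; apply: L2_bound => //.
  by apply: cmeasM; [exact: cmeas_symb|exact: L2_cmeas].
by move=> z Dz; rewrite normcM ler_wpM2r ?normc_ge0// symb_le.
Qed.

Lemma in_bergman_cont h z : in_bergman h -> disk z -> exists d, hol h z d.
Proof. by move=> [_ ah _] Dz; exact: analytic_hol. Qed.

Lemma in_bergman_nrm2_eq0 h : in_bergman h -> nrm2 h = 0 -> forall z, h z = 0.
Proof.
move=> bh h0 z; have [Lh ah out] := bh.
have [Dz|nDz] := pselect (disk z); last exact: out.
apply: (nrm2_eq0 Lh h0 Dz) => e e0.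
have [d' hd] := in_bergman_cont bh Dz.
have [t t0 tP] := sdiff_cont hd e0.
by exists t => // w wz; have [] := tP w w wz wz.
Qed.

(** If [f] is nonzero at a point it is nonzero nearby, so the symbol vanishes on a small disk
    together with its partial derivatives, contradicting [alpha != 0]. *)
Lemma symb_mul_eq0 f : (0 < m)%N -> alpha != 0 -> in_bergman f ->
  (forall z, disk z -> symb z * f z = 0) -> forall z, f z = 0.
Proof.
move=> m0 a0 bf sf z; have [Lf af out] := bf.
have [Dz|nDz] := pselect (disk z); last exact: out.
apply/eqP; apply: contrapT => /negP fz.
have [d' hd] := in_bergman_cont bf Dz.
have n2 : 0 < normc (f z) / 2 by rewrite divr_gt0// normc_gt0.
have [t t0 tP] := sdiff_cont hd n2.
have /diskE z1 := Dz.
pose r := Num.min t (1 - normc z).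
have r0 : 0 < r by rewrite lt_min t0 subr_gt0.
have s0 w : normc (w - z) < r -> symb w = 0.
  rewrite lt_min => /andP[wt w1].
  have Dw : disk w by apply/diskE; have := normc_subD w z; lra.
  have := sf w Dw => /eqP; rewrite mulf_eq0 => /orP[/eqP//|/eqP fw].
  have [+ _] := tP w w wt wt; rewrite fw sub0r normcN.
  by move=> h; exfalso; have := normc_gt0 fz; clear fw; lra.
(* A point other than 0 is taken because the derivative of [z ^+ m] vanishes at 0 when [m > 1]. *)
have [w wz w0] : exists2 w, normc (w - z) < r & w != 0.
  have [->|zn] := eqVneq z 0; last by exists z => //; rewrite subrr normc0.
  exists (r / 2)%:C.
    by rewrite subr0 normc_real gtr0_norm; lra.
  by rewrite eq_complex /= eqxx andbT gt_eqF// divr_gt0.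
have sw : sdiff symb w 0 0.
  apply: (@sdiff_eq _ (fun=> 0) _ _ _ _ (r - normc (w - z))).
  - by rewrite subr_gt0.
  - by move=> x xw; rewrite s0//; have := normc_dist_trans w x z; lra.
  - exact: sdiff_cst.
have [p0 q0] := sdiff_uniq (sdiff_symb w) sw.
have i2 : 'i * 'i = -1 :> R[i] by rewrite -expr2 sqr_i.
have ic : ('i)^*%C = - 'i :> R[i] by apply/eqP; rewrite eq_complex /= oppr0 !eqxx.
(* The x-derivative minus ['i] times the y-derivative is twice the holomorphic derivative; the
   antiholomorphic term drops out. *)
have : 2 * alpha * d w = 0.
  transitivity ((gamma * (d w)^*%C + alpha * d w) -
    'i * (gamma * ('i * d w)^*%C + alpha * ('i * d w))); last by rewrite p0 q0 mulr0 subrr.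
  have -> : ('i * d w)^*%C = - 'i * (d w)^*%C by rewrite -ic -rmorphM.
  transitivity ((gamma * (d w)^*%C + alpha * d w) +
    ('i * 'i) * (gamma * (d w)^*%C - alpha * d w)); last by ring.
  by rewrite i2; ring.
move/eqP; rewrite !mulf_eq0 pnatr_eq0 /= (negPf a0) /= expf_eq0 (negPf w0) andbF orbF.
by rewrite pnatr_eq0 -leqn0 leqNgt m0.
Qed.

End Phi.

Lemma powser_mulX a (F : R[i] -> R[i]) (r : R) z : 0 < r -> powser a F r ->
  powser (fun n => z * a n + (if n is n'.+1 then a n' else 0))
    (fun u => (z + u) * F u) r.
Proof.
move=> r0 aF u ur e e0; pose c := normc z + r + 1.
have z0 := normc_ge0 z; have c0 : 0 < c by rewrite /c; lra.
have [|N hN] := aF u ur (e / c); first by rewrite divr_gt0.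
exists N.+1 => -[//|n] Nn; have h1 := hN n.+1 (leqW Nn); have h2 := hN n Nn.
have -> : \sum_(k < n.+1) (z * a k + match k : nat with | 0%N => 0 | n'.+1 => a n' end) * u ^+ k =
    z * (\sum_(k < n.+1) a k * u ^+ k) + u * (\sum_(k < n) a k * u ^+ k).
  under eq_bigr do rewrite mulrDl -mulrA.
  rewrite big_split /= -mulr_sumr; congr (_ + _).
  rewrite big_ord_recl /= mul0r add0r mulr_sumr; apply: eq_bigr => i _.
  by rewrite /bump /= add1n exprS; ring.
set S := \sum_(_ < n.+1) _ in h1 *; set T := \sum_(_ < n) _ in h2 *.
rewrite (_ : _ - _ = z * (F u - S) + u * (F u - T)); last by ring.
apply: le_trans (le_normcD _ _) _; rewrite !normcM.
have ec : 0 <= e / c by rewrite divr_ge0// ltW.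
apply: (@le_trans _ _ (normc z * (e / c) + r * (e / c))).
  apply: lerD; first by rewrite ler_wpM2l.
  by apply: ler_pM; rewrite ?normc_ge0// ltW.
apply: (@le_trans _ _ (c * (e / c))).
  by rewrite -mulrDl ler_wpM2r// /c lerDl.
by rewrite mulrC divfK// gt_eqF.
Qed.

Lemma in_bergman_mulX h : in_bergman h -> in_bergman (fun z => z * h z).
Proof.
move=> [Lh ah out]; split; last by move=> z /out ->; rewrite mulr0.
  have [] // := @L2_bound _ h (fun z => z * h z) 1 _ Lh.
    by apply: cmeasM; [exact: cmeas_id|exact: L2_cmeas].
  by move=> z /diskE z1; rewrite normcM ler_wpM2r ?normc_ge0// ltW.
apply/analytic_powser => z Dz; have /analytic_powser/(_ z Dz)[a [r [r0 ar]]] := ah.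
by exists (fun n => z * a n + (if n is n'.+1 then a n' else 0)), r; split=> //;
  exact: powser_mulX.
Qed.

Lemma in_bergman_mulXn h n : in_bergman h -> in_bergman (fun z => z ^+ n * h z).
Proof.
move=> bh; elim: n => [|n /in_bergman_mulX].
  by under eq_fun do rewrite expr0 mul1r.
by under eq_fun do rewrite mulrA -exprS.
Qed.

(** The unit constant as an element of the Bergman space, hence cut to 0 off the disk; it is the
    nonzero vector that refutes scalar operators. *)
Definition disk_cst : R[i] -> R[i] := fun z => if `[< disk z >] then 1 else 0.

Lemma in_bergman_disk_cst : in_bergman disk_cst.
Proof.
have one z : disk z -> disk_cst z = 1 by move=> Dz; rewrite /disk_cst asboolT.
split; last by move=> z nD; rewrite /disk_cst asboolF.
  have [m1 m2] := cmeas_cst (1 : R[i]).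
  have [] // := @L2_bound _ (fun=> 1) disk_cst 1 _ (L2_cst 1).
    split.
      apply: eq_measurable_fun m1 => p; rewrite inE => Dp.
      by rewrite one.
    apply: eq_measurable_fun m2 => p; rewrite inE => Dp.
    by rewrite one.
  by move=> z Dz; rewrite one// normc1 mul1r.
apply/analytic_powser => z /diskE z1.
exists (fun n => if n is 0%N then 1 else 0), (1 - normc z); split; first by rewrite subr_gt0.
move=> u uz e e0; exists 1%N => -[//|n] _.
rewrite one; last by apply/diskE; apply: le_lt_trans (le_normcD _ _) _; lra.
rewrite big_ord_recl /= expr0 mul1r big1 ?addr0 ?subrr ?normc0 ?ltW// => i _.
by rewrite mul0r.
Qed.

Lemma disk_cst_neq0 : disk_cst 0 <> 0.
Proof.
rewrite /disk_cst asboolT; last by apply/diskE; rewrite normc0.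
by apply/eqP; exact: oner_neq0.
Qed.

(* With [w = z^m], testing against [f] gives
   [alpha M + gamma M^* + beta N = 0] where [M = <w f, f>] and [N = <f, f>].
   For [w0 = M / N] and [zeta = w - w0] the symbol is thus
   [alpha zeta + gamma zeta^*], and testing against [alpha zeta f] gives
   [|| symb f ||^2 + || alpha zeta f ||^2 = || gamma zeta^* f ||^2]. *)
Lemma symb_kernel m alpha beta gamma f : (0 < m)%N -> alpha != 0 ->
  normc gamma <= normc alpha -> in_bergman f ->
  (forall k, in_bergman k -> dotL2 (fun z => symb m alpha beta gamma z * f z) k = 0) ->
  forall z, f z = 0.
Proof.
move=> m0 a0 ga bf fk; have [Lf af out] := bf.
have [/(in_bergman_nrm2_eq0 bf)//|N0] := pselect (nrm2 f = 0).
have bWf := in_bergman_mulXn m bf; set Wf := fun z => z ^+ m * f z in bWf.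
have [LWf _ _] := bWf.
pose N := (nrm2 f)%:C; pose M := dotL2 Wf f; pose w0 := M / N.
have Nn0 : N != 0 by rewrite eq_complex /= eqxx andbT; apply/eqP.
have NJ : N^*%C = N by rewrite conjc_real.
have ms z : cmeas (fun w => symb m z 0 0 w) by exact: cmeas_symb.
pose cWf z := z^*%C ^+ m * f z.
have cW : cmeas (fun z => z^*%C ^+ m).
  by apply: cmeasX; apply: cmeas_conj; exact: cmeas_id.
have LcWf : L2 cWf.
  have [] // := @L2_bound _ f cWf 1 _ Lf.
    by apply: cmeasM => //; exact: L2_cmeas.
  move=> z /diskE z1; rewrite normcM ler_wpM2r ?normc_ge0// normcX normc_conj.
  by rewrite exprn_ile1 ?normc_ge0// ltW.
have dcW : dotL2 cWf f = M^*%C.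
  rewrite -(dotL2C LWf Lf); apply: eq_cintegral => z _.
  by rewrite /cWf /Wf rmorphM rmorphXn /=; ring.
have betaE : beta = - (alpha * w0) - gamma * w0^*%C.
  have := fk f bf.
  rewrite (@eq_dotL2 _ _ _ (fun z => gamma * cWf z + (alpha * Wf z + beta * f z)) f); first last.
  - by [].
  - by move=> z _; rewrite /symb /cWf /Wf; ring.
  rewrite (dotL2Dl (L2_scale _ LcWf) (L2_add (L2_scale _ LWf) (L2_scale _ Lf)) Lf).
  rewrite (dotL2Dl (L2_scale _ LWf) (L2_scale _ Lf) Lf).
  rewrite (dotL2Zl gamma LcWf Lf) (dotL2Zl alpha LWf Lf) (dotL2Zl beta Lf Lf).
  rewrite dcW -/M (dotL2_nrm2 Lf) -/N => E.
  have -> : w0^*%C = M^*%C / N.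
    transitivity (M^*%C * (N^-1)^*%C); first exact: rmorphM.
    by rewrite conjc_inv NJ.
  rewrite /w0.
  have -> : - (alpha * (M / N)) - gamma * (M^*%C / N) = beta -
    (gamma * M^*%C + (alpha * M + beta * N)) / N by field.
  by rewrite E mul0r subr0.
pose zf z := alpha * (z ^+ m - w0) * f z.
have bzf : in_bergman zf.
  have := in_bergmanZD alpha bWf (in_bergmanZD (- (alpha * w0)) bf in_bergman0).
  congr in_bergman; apply/funext => z; rewrite /Wf /zf; ring.
have [Lzf _ _] := bzf.
have [Lsf _] := symb_L2 m alpha beta gamma Lf; set sf := fun z => _ * f z in Lsf.
have orth : dotL2 sf zf = 0 by exact: fk.
pose czf z := gamma * (z ^+ m - w0)^*%C * f z.
have sfE z : sf z - zf z = czf z.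
  by rewrite /sf /zf /czf /symb betaE rmorphB rmorphXn /=; ring.
have mczf : cmeas czf.
  have -> : czf = fun z => sf z - zf z by apply/funext => z; rewrite sfE.
  by apply: cmeasB; exact: L2_cmeas.
have [|_ czf_le] := @L2_bound _ zf czf 1 mczf Lzf.
  move=> z _; rewrite mul1r /czf /zf !normcM normc_conj.
  do 2 (apply: ler_wpM2r; first exact: normc_ge0).
  exact: ga.
have sf0 : nrm2 sf = 0.
  have := nrm2B Lsf Lzf; rewrite orth mulr0 subr0 => h.
  have := czf_le; rewrite -(eq_nrm2 (fun z _ => sfE z)) h expr1n mul1r.
  rewrite -lerBrDr subrr => h0.
  by apply/eqP; rewrite eq_le h0 nrm2_ge0.
(* The product of the symbol and [f] is continuous, so its zero norm makes it vanish at every point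
   of the disk. *)
apply: (symb_mul_eq0 m0 a0 bf) => z Dz.
apply: (nrm2_eq0 Lsf sf0 Dz) => e e0.
have [d' hd] := in_bergman_cont bf Dz.
have [t t0 tP] := sdiff_cont (sdiffM (sdiff_symb m alpha beta gamma z) hd) e0.
exists t; first exact: t0.
by move=> w wz; exact: (tP w w wz wz).1.
Qed.

Lemma symb_conj m alpha beta gamma z :
  (symb m alpha beta gamma z)^*%C = symb m gamma^*%C beta^*%C alpha^*%C z.
Proof.
rewrite /symb rmorphD rmorphD rmorphM rmorphM !rmorphXn /= conjcK.
by rewrite (addrC (_ * _)).
Qed.

Lemma dotL2_symb m alpha beta gamma f g : L2 f -> L2 g ->
  dotL2 (fun z => symb m alpha beta gamma z * f z) g =
  (dotL2 (fun z => symb m gamma^*%C beta^*%C alpha^*%C z * g z) f)^*%C.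
Proof.
move=> Lf Lg; have [Ls _] := symb_L2 m gamma^*%C beta^*%C alpha^*%C Lg.
rewrite -(dotL2C Ls Lf); apply: eq_cintegral => z _.
by rewrite rmorphM /= symb_conj !conjcK; ring.
Qed.

(** The alternative is decided by the moduli of [alpha] and [gamma] alone, so [beta] is quantified
    inside each side. The same side then serves for [beta] itself and for [beta - c] when a scalar
    [c] is to be excluded. *)
Lemma symb_dichotomy m alpha gamma : (0 < m)%N -> (alpha, gamma) <> (0, 0) ->
  (forall beta f, in_bergman f -> (forall k, in_bergman k ->
     dotL2 (fun z => symb m alpha beta gamma z * f z) k = 0) -> forall z, f z = 0) \/
  (forall beta g, in_bergman g -> (forall k, in_bergman k ->
     dotL2 (fun z => symb m alpha beta gamma z * k z) g = 0) -> forall z, g z = 0).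
Proof.
move=> m0 ag; have [ga|ga] := leP (normc gamma) (normc alpha).
  left=> beta f; apply: symb_kernel => //; apply/eqP => a0; apply: ag.
  move: ga; rewrite a0 normc0 => g0; congr (_, _); apply/normc_eq0P/eqP.
  by rewrite eq_le g0 normc_ge0.
right=> beta g bg gk; have [Lg _ _] := bg.
apply: (@symb_kernel m gamma^*%C beta^*%C alpha^*%C) => //.
- rewrite conjc_eq0; apply/eqP => g0; move: ga; rewrite g0 normc0.
  by rewrite ltNge normc_ge0.
- by rewrite !normc_conj ltW.
- move=> k bk; have [Lk _ _] := bk; have := gk k bk.
  rewrite (dotL2_symb _ _ _ _ Lk Lg) => /eqP.
  by rewrite conjc_eq0 => /eqP.
Qed.

End Symbol.

(** * Toeplitz operators and their adjoints *)

Section Toeplitz.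
Context {R : realType}.
Implicit Types (f g k : bergman R).

Lemma bergman_in f : in_bergman f.
Proof. exact/in_bergmanP/bergmanP. Qed.

Lemma bergman_L2 f : L2 f. Proof. by have [] := bergman_in f. Qed.

Lemma bergman_ext f g : (forall z, f z = g z) -> f = g.
Proof. by move=> fg; apply: val_inj; apply/funext. Qed.

Lemma bergman_onto h : in_bergman h -> exists f : bergman R, forall z, f z = h z.
Proof. by move=> /in_bergmanP bh; exists (Bergman bh). Qed.

Lemma bergman_ZDE (c : R[i]) f g z : (c *: f + g) z = c * f z + g z.
Proof. by []. Qed.

Lemma dot_nondegenerate f g :
  (forall k, dotL2 f k = dotL2 g k) -> f = g.
Proof.
move=> fg; apply: bergman_ext => z; apply/eqP; rewrite -subr_eq0; apply/eqP.
have Lf := bergman_L2 f; have Lg := bergman_L2 g.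
pose h : bergman R := (-1) *: g + f.
have hE w : h w = f w - g w by rewrite bergman_ZDE mulN1r addrC.
have := in_bergman_nrm2_eq0 (bergman_in h); rewrite -hE; apply.
rewrite /nrm2 (@eq_dotL2 _ _ h (fun w => f w - g w) h)// (dotL2Bl Lf Lg (bergman_L2 h)).
by rewrite fg subrr.
Qed.

Section Op.
Context (m : nat) (alpha beta gamma : R[i]).
Let phi := symb m alpha beta gamma.
Local Notation T := (toeplitz phi).

(** Existence of the projection replaces the default-valued choice by its defining orthogonality;
    the facts about [T] below rest on this identity. *)
Lemma toeplitz_dot f k : dotL2 (T f) k = dotL2 (fun z => phi z * f z) k.
Proof.
have [Ls _] := symb_L2 m alpha beta gamma (bergman_L2 f).
have [h hP] := bergman_proj_ex Ls.
have /(_ k) := @xgetPex _ 0 [set h : bergman R | forall k : bergman R,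
    dotL2 (fun z => phi z * f z - h z) k = 0] (ex_intro _ h hP).
rewrite -[xget _ _]/(T f) (dotL2Bl Ls (bergman_L2 _) (bergman_L2 _)).
by move/eqP; rewrite subr_eq0 => /eqP.
Qed.

Lemma toeplitz_linear : linear T.
Proof.
move=> c f g; apply: dot_nondegenerate => k.
have Lk := bergman_L2 k.
have [Lf _] := symb_L2 m alpha beta gamma (bergman_L2 f).
have [Lg _] := symb_L2 m alpha beta gamma (bergman_L2 g).
rewrite toeplitz_dot.
rewrite (@eq_dotL2 _ _ k (fun z => c * (phi z * f z) + phi z * g z) k)//; last first.
  by move=> z _; rewrite bergman_ZDE; ring.
rewrite (dotL2Dl (L2_scale c Lf) Lg Lk) (dotL2Zl c Lf Lk) -!toeplitz_dot.
rewrite (@eq_dotL2 _ (c *: T f + T g) k (fun z => c * T f z + T g z) k)//.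
by rewrite (dotL2Dl (L2_scale c (bergman_L2 _)) (bergman_L2 _) Lk) (dotL2Zl c (bergman_L2 _) Lk).
Qed.

(** [T f] is orthogonal to [phi f - T f], so by Pythagoras its norm is at most that of [phi f]. *)
Lemma toeplitz_bounded : exists M : R, forall f,
  hnorm (@bergman_dot R) (T f) <= M * hnorm (@bergman_dot R) f.
Proof.
exists (symb_bound alpha beta gamma) => f.
have b0 : 0 <= symb_bound alpha beta gamma by rewrite !addr_ge0// normc_ge0.
rewrite /hnorm -!/(nrm2 _) -[symb_bound _ _ _]ger0_norm// -sqrtr_sqr -sqrtrM ?sqr_ge0//.
rewrite ler_wsqrtr//.
have [Ls hs] := symb_L2 m alpha beta gamma (bergman_L2 f); apply: le_trans hs.
set s := fun z => _ * f z in Ls *.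
have LT := bergman_L2 (T f).
have := nrm2D (L2_sub Ls LT) LT.
rewrite (dotL2Bl Ls LT LT) toeplitz_dot subrr mulr0 addr0.
rewrite (@eq_nrm2 _ _ s) => [->|z _]; last by ring.
by rewrite lerDr nrm2_ge0.
Qed.

Lemma dotL2_0l k : dotL2 (0 : bergman R) k = 0.
Proof.
by rewrite (@eq_dotL2 _ 0 k (fun=> 0) k)// L2_dotL2_cst ?mul0r//; exact: bergman_L2.
Qed.

Lemma dotL2_0r k : dotL2 k (0 : bergman R) = 0.
Proof. by rewrite (dotL2C (bergman_L2 0) (bergman_L2 k)) dotL2_0l conjc0. Qed.

Lemma toeplitz_0 : T 0 = 0.
Proof.
apply: dot_nondegenerate => k; rewrite toeplitz_dot.
by apply: eq_dotL2 => // z _; rewrite mulr0.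
Qed.

Lemma toeplitz_ker f : T f = 0 ->
  forall k : R[i] -> R[i], in_bergman k -> dotL2 (fun z => phi z * f z) k = 0.
Proof.
move=> Tf k /bergman_onto[k' kE].
by rewrite -(eq_dotL2 (fun z _ => erefl) (fun z _ => kE z)) -toeplitz_dot Tf dotL2_0l.
Qed.

(** The projection of the conjugate symbol times [g] is an explicit candidate, so the choice in
    [adjoint] is realized without appeal to the Riesz theorem. *)
Lemma adjoint_dot f g :
  dotL2 (T f) g = dotL2 f (adjoint (@bergman_dot R) T g).
Proof.
pose S : set (bergman R) := [set h | forall f, bergman_dot (T f) g = bergman_dot f h].
have [Ls _] := symb_L2 m gamma^*%C beta^*%C alpha^*%C (bergman_L2 g).
have [h hP] := bergman_proj_ex Ls.
have Sh : S h.
  move=> f'; rewrite /bergman_dot toeplitz_dot.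
  rewrite (dotL2_symb _ _ _ _ (bergman_L2 f') (bergman_L2 g)).
  rewrite (dotL2C (bergman_L2 h) (bergman_L2 f')); congr (_^*%C).
  apply/eqP; rewrite -subr_eq0 -(dotL2Bl Ls (bergman_L2 h) (bergman_L2 f')).
  by apply/eqP; exact: hP.
exact: (@xgetPex _ 0 S (ex_intro _ h Sh) f).
Qed.

Lemma adjoint_0 : adjoint (@bergman_dot R) T 0 = 0.
Proof.
set a := adjoint _ _ _; apply: dot_nondegenerate => k.
rewrite dotL2_0l (dotL2C (bergman_L2 k) (bergman_L2 a)) -adjoint_dot.
by rewrite dotL2_0r conjc0.
Qed.

Lemma adjoint_ker g : adjoint (@bergman_dot R) T g = 0 ->
  forall k : R[i] -> R[i], in_bergman k -> dotL2 (fun z => phi z * k z) g = 0.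
Proof.
move=> Tg k /bergman_onto[k' kE].
rewrite -(@eq_dotL2 _ (fun z => phi z * k' z) g _ g)// => [|z _]; last by rewrite kE.
by rewrite -toeplitz_dot adjoint_dot Tg dotL2_0r.
Qed.

Lemma toeplitz_scalar (c : R[i]) : (forall f, T f = c *: f) ->
  forall h k : R[i] -> R[i], in_bergman h -> in_bergman k ->
  dotL2 (fun z => symb m alpha (beta - c) gamma z * h z) k = 0.
Proof.
move=> Tc _h _k /bergman_onto[h hE] /bergman_onto[k kE].
have [Ls _] := symb_L2 m alpha beta gamma (bergman_L2 h).
rewrite (@eq_dotL2 _ _ _ (fun z => phi z * h z - (c *: h) z) k).
- by rewrite (dotL2Bl Ls (bergman_L2 _) (bergman_L2 k)) -toeplitz_dot Tc subrr.
- by move=> z _; rewrite -hE -[(c *: h) z]/(c * h z) /phi /symb; ring.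
- by move=> z _; rewrite kE.
Qed.

End Op.
End Toeplitz.

Theorem corollary5p8 (R : realType) (m : nat) (hm : (1 <= m)%N)
    (alpha beta gamma : R[i]) (hag : (alpha, gamma) <> (0, 0)) :
  coburn_type (@bergman_dot R)
    (toeplitz (fun z : R[i] => gamma * (z^*%C) ^+ m + alpha * z ^+ m + beta)).
Proof.
rewrite -[fun z : R[i] => _]/(symb m alpha beta gamma).
have dich := symb_dichotomy hm hag; split.
- by split; [exact: toeplitz_linear|exact: toeplitz_bounded].
- move=> [c /toeplitz_scalar Tc]; have b1 := @in_bergman_disk_cst R.
  (* If [T] were the scalar [c], every pairing with the symbol for [beta - c] would vanish, and
     either alternative would force the unit constant to be 0. *)
  case: dich => /(_ (beta - c) _ b1) H; apply: (@disk_cst_neq0 R); apply: H => k bk.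
    exact: (Tc _ _ b1 bk).
  exact: (Tc _ _ bk b1).
- case: dich => /(_ beta) H; [left|right]; apply/seteqP; split=> f /=.
  + by move=> /toeplitz_ker Tf; apply: bergman_ext; apply: H (bergman_in f) Tf.
  + by move=> ->; exact: toeplitz_0.
  + by move=> /adjoint_ker Tf; apply: bergman_ext; apply: H (bergman_in f) Tf.
  + by move=> ->; exact: adjoint_0.
Qed.
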